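(* Let $K$ be a field, $S=K[x_1,\dots,x_n]$, and let $I\subseteq S$ be a right PLP-polymatroidal ideal with data $k$, $d$, $\alpha_1,\dots,\alpha_k$, $\beta_1,\dots,\beta_k$, $b_{k+1},\dots,b_n$; set $\beta_0=0$. Suppose $\alpha_i<\beta_i$ for $i=1,\dots,k$ and $d<\beta_k+\mathbf b([k+1,n])$. Let $1\le s\le t\le k$ and let $B$ be a nonempty subset of $[k+1,n]$. Then: (a) $P_{[s,t]}\in\operatorname{Ass}^\infty(S/I)$ if and only if $P_{[s,t]}\in\operatorname{Ass}(S/I)$. (b) $P_B\in\operatorname{Ass}^\infty(S/I)$ if and only if $\mathbf b([k+1,n]\setminus B)+\beta_k<d$. (c) $P_{[s,k]\cup B}\in\operatorname{Ass}^\infty(S/I)$ if and only if $\mathbf b([k+1,n]\setminus B)+\max\{\beta_{s-1},\alpha_k\}<d$ and $\beta_{s-1}<\beta_s$. Moreover, $\operatorname{Ass}^\infty(S/I)$ consists exactly of the monomial prime ideals of the forms $P_{[s,t]}$ ($1\le s\le t\le k$), $P_B$, $P_{[s,k]\cup B}$ ($1\le s\le k$, $\emptyset\ne B\subseteq[k+1,n]$) which satisfy the corresponding condition in (a), (b) or (c).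
   Context: For integers $p\le q$, $[p,q]=\{p,\dots,q\}$. For $A\subseteq\{1,\dots,n\}$, $P_A=(x_i:i\in A)$; for $A\subseteq[k+1,n]$, $\mathbf b(A)=\sum_{i\in A}b_i$. $\operatorname{Ass}^\infty(S/I)$ is the set of prime ideals $P$ with $P\in\operatorname{Ass}(S/I^m)$ for all $m\gg0$. Right PLP-polymatroidal ideal: let $n,k,d$ be positive integers with $1\le k\le n-1$, let $\alpha_i,\beta_i$ $(1\le i\le k)$ be non-negative integers with $\alpha_i\le\beta_i$ for all $i$, $\alpha_1\le\cdots\le\alpha_k\le d$, $0<\beta_1\le\cdots\le\beta_k\le d$, and let $b_{k+1},\dots,b_n$ be positive integers with $d\le\beta_k+b_{k+1}+\cdots+b_n$. The corresponding right PLP-polymatroidal ideal $I$ is the (nonzero) monomial ideal of $S$ generated by all $x_1^{u_1}\cdots x_n^{u_n}$, with $u_i$ non-negative integers, such that $\alpha_i\le u_1+\cdots+u_i\le\beta_i$ for $i=1,\dots,k$, $0\le u_i\le b_i$ for $i=k+1,\dots,n$, and $u_1+\cdots+u_n=d$. *)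

(* Defs.v *)
From HB Require Import structures.
From mathcomp Require Import all_boot all_order all_algebra.
From mathcomp Require Export mpoly.

Set Implicit Arguments.
Unset Strict Implicit.
Unset Printing Implicit Defensive.

Import GRing.Theory.

(* Ideals are Prop-valued predicates: the idealr structures of ring_quotient
   are boolean and proper, whereas a power or a colon of an ideal carries no
   canonical decision procedure and may be the unit ideal. *)
Section Ideals.
Local Open Scope ring_scope.
Variable R : comNzRingType.

Definition is_ideal (I : R -> Prop) : Prop :=
  [/\ I 0, forall x y, I x -> I y -> I (x + y)
    & forall a x, I x -> I (a * x)].

Definition is_prime_ideal (P : R -> Prop) : Prop :=
  [/\ is_ideal P, ~ P 1 & forall x y, P (x * y) -> P x \/ P y].

Definition ideal_eq (I J : R -> Prop) : Prop := forall f, I f <-> J f.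

Definition ideal_gen (G : R -> Prop) : R -> Prop := fun f =>
  exists (m : nat) (c g : 'I_m -> R),
    (forall i, G (g i)) /\ f = \sum_(i < m) c i * g i.

Definition ideal_mul (I J : R -> Prop) : R -> Prop :=
  ideal_gen (fun f => exists x y, [/\ I x, J y & f = x * y]).

Fixpoint ideal_exp (I : R -> Prop) (m : nat) : R -> Prop :=
  if m is m'.+1 then ideal_mul I (ideal_exp I m') else fun=> True.

(* I : f, that is, the annihilator of the class of f in the module R / I. *)
Definition ideal_colon (I : R -> Prop) (f : R) : R -> Prop :=
  fun g => I (g * f).

(* P \in Ass(R / I) *)
Definition Ass (I P : R -> Prop) : Prop :=
  is_prime_ideal P /\ exists f : R, ideal_eq P (ideal_colon I f).

(* P \in Ass^\infty(R / I) *)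
Definition Ass_infty (I P : R -> Prop) : Prop :=
  is_prime_ideal P /\
  exists m0 : nat, forall m : nat, (m0 <= m)%N -> Ass (ideal_exp I m) P.

End Ideals.

(* Indices are 1-based as in the mathematics: the integer i in {1, ..., n} is
   the ordinal j : 'I_n with j.+1 = i. The data alpha, beta, b are functions on
   nat of which only alpha_1..alpha_k, beta_0..beta_k and b_(k+1)..b_n are ever
   used. *)

(* [s, t] as a subset of {1, ..., n} *)
Definition intv (n s t : nat) : {set 'I_n} := [set j : 'I_n | s <= j.+1 <= t].

Definition bsum (n : nat) (b : nat -> nat) (A : {set 'I_n}) : nat :=
  \sum_(j in A) b j.+1.

Definition var_prime (K : fieldType) (n : nat) (A : {set 'I_n}) :
    {mpoly K[n]} -> Prop :=
  ideal_gen (fun f : {mpoly K[n]} => exists2 j, j \in A & f = 'X_j).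

Record right_plp_data (n k d : nat) (alpha beta b : nat -> nat) : Prop :=
  RightPLPData {
    plp_k : 1 <= k < n;
    plp_d : 0 < d;
    plp_alpha_beta : forall i, 1 <= i <= k -> alpha i <= beta i;
    plp_alpha_mono : forall i, 1 <= i < k -> alpha i <= alpha i.+1;
    plp_alpha_d : alpha k <= d;
    plp_beta_gt0 : 0 < beta 1;
    plp_beta_mono : forall i, 1 <= i < k -> beta i <= beta i.+1;
    plp_beta_d : beta k <= d;
    plp_b_gt0 : forall i, k < i <= n -> 0 < b i;
    plp_d_le : d <= beta k + bsum b (intv n k.+1 n)
  }.

Definition right_plp_exponent (n k d : nat) (alpha beta b : nat -> nat)
    (u : 'X_{1..n}) : Prop :=
  [/\ forall i, 1 <= i <= k ->
        alpha i <= \sum_(j in intv n 1 i) u j <= beta i,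
      forall j : 'I_n, k < j.+1 -> u j <= b j.+1
    & mdeg u = d].

Definition right_plp_ideal (K : fieldType) (n k d : nat)
    (alpha beta b : nat -> nat) : {mpoly K[n]} -> Prop :=
  ideal_gen (fun f : {mpoly K[n]} =>
    exists2 u, right_plp_exponent k d alpha beta b u & f = 'X_[u]).

Arguments var_prime K {n} A.
Arguments right_plp_ideal K n k d alpha beta b : clear implicits.

(* Main.v *)
(* The powers of I are intersections of powers of monomial primes. The level-m
   exponent set, defined by m alpha, m beta, m b, m d, is the m-fold sum of the
   level-1 set: rounding down the cumulative sums of a level-m exponent divided
   by m splits off a level-1 exponent. A greedy choice of cumulative sums shows
   that x^u lies in I^m iff u satisfies, for all j and i and all C in [k+1, n],
     u_(j+1) + ... + u_i >= m (alpha_i - beta_j)  and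
     u_(j+1) + ... + u_k + u(C) >= m (d - beta_j - b([k+1, n] - C)),
   so the exponents of the primes grow linearly in m. For an intersection of
   powers P_A^(e_A), the prime P_A is associated iff some w has w(A) = e_A - 1
   and meets the constraints of all proper subsets of A. Comparing A with its
   subsets without the first block, last block or tail gives the necessary
   conditions, and explicit cumulative sums w give sufficiency: for intervals
   at every level m >= 1, for sets meeting the tail once m >= n. *)
Require Import Defs.
From mathcomp Require Import all_boot all_order all_algebra.
From mathcomp Require Import zify.
From Stdlib Require Import Classical.

Set Implicit Arguments.
Unset Strict Implicit.
Unset Printing Implicit Defensive.

Import GRing.Theory.

(** * Generated ideals, their powers, and associated primes up to equality of ideals *)

Section Ideals.
Local Open Scope ring_scope.
Variable R : comNzRingType.
Implicit Types I J P : R -> Prop.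

Lemma is_ideal_sum I (T : Type) (r : seq T) (Q : pred T) (F : T -> R) :
  is_ideal I -> (forall i, Q i -> I (F i)) -> I (\sum_(i <- r | Q i) F i).
Proof. by case=> I0 ID _ IF; elim/big_ind: _. Qed.

Lemma is_idealB I x y : is_ideal I -> I x -> I y -> I (x - y).
Proof. by case=> _ ID IM Ix Iy; rewrite -mulN1r; apply: ID => //; apply: IM. Qed.

Lemma ideal_gen_ideal (G : R -> Prop) : is_ideal (ideal_gen G).
Proof.
split.
- by exists 0%N, (fun=> 0), (fun=> 0); split; [case | rewrite big_ord0].
- move=> x y [m [c [g [Gg ->]]]] [m' [c' [g' [Gg' ->]]]].
  pose glue (h : 'I_m -> R) (h' : 'I_m' -> R) i :=
    match split i with inl j => h j | inr j => h' j end.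
  exists (m + m')%N, (glue c c'), (glue g g'); split=> [i|].
    by rewrite /glue; case: (split i).
  rewrite big_split_ord /=; congr (_ + _); apply: eq_bigr => i _.
    by rewrite /glue (unsplitK (inl i)).
  by rewrite /glue (unsplitK (inr i)).
- move=> a x [m [c [g [Gg ->]]]]; exists m, (fun i => a * c i), g; split=> //.
  by rewrite mulr_sumr; apply: eq_bigr => i _; rewrite mulrA.
Qed.

Lemma ideal_genW (G : R -> Prop) x : G x -> ideal_gen G x.
Proof.
move=> Gx; exists 1%N, (fun=> 1), (fun=> x); split=> //.
by rewrite big_ord_recl big_ord0 mul1r addr0.
Qed.

Lemma ideal_gen_min (G I : R -> Prop) x :
  is_ideal I -> (forall y, G y -> I y) -> ideal_gen G x -> I x.
Proof.
move=> idI GI [m [c [g [Gg ->]]]]; apply: is_ideal_sum => // i _.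
by case: idI => _ _; apply; apply: GI.
Qed.

Lemma ideal_eq_refl I : ideal_eq I I.
Proof. by []. Qed.

Lemma ideal_eq_sym I J : ideal_eq I J -> ideal_eq J I.
Proof. by move=> IJ f; split=> /IJ. Qed.

Lemma ideal_eq_trans I J P : ideal_eq I J -> ideal_eq J P -> ideal_eq I P.
Proof. by move=> IJ JP f; rewrite IJ. Qed.

Lemma ideal_gen_eq (G G' : R -> Prop) :
  ideal_eq G G' -> ideal_eq (ideal_gen G) (ideal_gen G').
Proof.
move=> GG' f; split; apply: ideal_gen_min; try exact: ideal_gen_ideal;
  by move=> y /GG' Gy; apply: ideal_genW.
Qed.

Lemma ideal_mul_eq I I' J J' :
  ideal_eq I I' -> ideal_eq J J' -> ideal_eq (ideal_mul I J) (ideal_mul I' J').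
Proof.
move=> II' JJ'; apply: ideal_gen_eq => f.
by split=> -[x [y [/II' Ix /JJ' Jy ->]]]; exists x, y.
Qed.

Lemma ideal_exp_eq I I' m :
  ideal_eq I I' -> ideal_eq (ideal_exp I m) (ideal_exp I' m).
Proof. by move=> II'; elim: m => //= m; apply: ideal_mul_eq. Qed.

Lemma ideal_exp1 I : is_ideal I -> ideal_eq (ideal_exp I 1) I.
Proof.
move=> idI f; split=> [|If].
  apply: ideal_gen_min => // _ [x [y [Ix _ ->]]].
  by rewrite mulrC; case: idI => _ _; apply.
by apply: ideal_genW; exists f, 1; rewrite mulr1.
Qed.

Lemma is_prime_ideal_eq P P' :
  ideal_eq P P' -> is_prime_ideal P -> is_prime_ideal P'.
Proof.
move=> PP' [[P0 PD PM] P1 PX]; split.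
- split; first exact/PP'.
  + by move=> x y /PP' Px /PP' Py; apply/PP'/PD.
  + by move=> a x /PP' Px; apply/PP'/PM.
- by move/PP'.
- by move=> x y /PP' /PX [] /PP'; [left | right].
Qed.

Lemma Ass_eq I I' P P' :
  ideal_eq I I' -> ideal_eq P P' -> Ass I P -> Ass I' P'.
Proof.
move=> II' PP' [prP [f Pf]]; split; first exact: is_prime_ideal_eq prP.
exists f => g; split; first by move/PP'/Pf; rewrite /ideal_colon => /II'.
by rewrite /ideal_colon => /II' /Pf /PP'.
Qed.

End Ideals.

(** * Monomial ideals and their associated primes *)

Section MonomialIdeals.
Local Open Scope ring_scope.
Variables (K : fieldType) (n : nat).
Implicit Types (f g h : {mpoly K[n]}) (u v w : 'X_{1..n}) (A : {set 'I_n}).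
Implicit Types (M : pred 'X_{1..n}) (P J : {mpoly K[n]} -> Prop).

Definition upclosed M := forall u v, M u -> M (u + v)%MM.

(** For upward closed [M] this is the monomial ideal with monomial set [M]. Testing membership term
    by term avoids choosing generators. *)
Definition mon_ideal M f : Prop := {in msupp f, forall u, M u}.

Lemma upclosed_le M u v : upclosed M -> (u <= v)%MM -> M u -> M v.
Proof. by move=> upM /submK <-; rewrite addmC; apply: upM. Qed.

Lemma mon_idealX M u : mon_ideal M 'X_[u] <-> M u.
Proof.
split=> [|Mu v]; first by apply; rewrite msuppX mem_seq1.
by rewrite msuppX mem_seq1 => /eqP->.
Qed.

Lemma mon_ideal_ideal M : upclosed M -> is_ideal (mon_ideal M).
Proof.
move=> upM; split=> [u|f g Mf Mg u|a f Mf u].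
- by rewrite msupp0.
- by move/msuppD_le; rewrite mem_cat => /orP[/Mf|/Mg].
- by case/msuppM_le/allpairsP=> -[v w] [_ /Mf Mw ->]; rewrite addmC; apply: upM.
Qed.

Lemma mon_ideal_min M J :
  is_ideal J -> (forall u, M u -> J 'X_[u]) -> forall f, mon_ideal M f -> J f.
Proof.
move=> idJ MJ f Mf; rewrite (mpolyE f) big_seq; apply: is_ideal_sum => // u uf.
by rewrite -mul_mpolyC; case: idJ => _ _; apply; apply/MJ/Mf.
Qed.

(** The normal form of [f] modulo [mon_ideal M]; it vanishes exactly when [f] lies in the ideal. *)
Definition outpart M f := \sum_(u <- msupp f | ~~ M u) f@_u *: 'X_[u].

Lemma mcoeff_outpart M f u : (outpart M f)@_u = if M u then 0 else f@_u.
Proof.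
rewrite raddf_sum /=.
under eq_bigr do rewrite mcoeffZ mcoeffX.
case: (boolP (u \in msupp f)) => [uf|uf]; last first.
  rewrite (memN_msupp_eq0 uf) if_same big_seq_cond big1 // => v /andP[vf _].
  by case: eqP => [vu|_]; [rewrite -vu vf in uf | rewrite mulr0].
case: ifP => Mu.
  by rewrite big1 // => v; case: eqP => [->|]; rewrite ?Mu ?mulr0.
rewrite (big_rem u) //= Mu eqxx mulr1 big_seq_cond big1 ?addr0 // => v.
by rewrite mem_rem_uniq ?msupp_uniq // inE => /andP[/andP[/negPf-> _] _];
   rewrite mulr0.
Qed.

Lemma msupp_outpart M f u :
  (u \in msupp (outpart M f)) = ~~ M u && (u \in msupp f).
Proof. by rewrite !mcoeff_msupp mcoeff_outpart; case: (M u); rewrite ?eqxx. Qed.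

Lemma outpartB M f : mon_ideal M (f - outpart M f).
Proof.
move=> u; rewrite mcoeff_msupp mcoeffB mcoeff_outpart.
by case: (M u) => //; rewrite subrr eqxx.
Qed.

Lemma mon_ideal_outM M f g : upclosed M ->
  mon_ideal M (g * outpart M f) <-> mon_ideal M (g * f).
Proof.
move=> upM; have idM := mon_ideal_ideal upM; have [_ ID IM] := idM.
have -> : g * f = g * outpart M f + g * (f - outpart M f).
  by rewrite -mulrDr addrC subrK.
have Mout : mon_ideal M (g * (f - outpart M f)) by exact/IM/outpartB.
split=> [Mf|Mf]; first exact: ID.
rewrite -[_ * outpart M f](addrK (g * (f - outpart M f))).
exact: (is_idealB idM).
Qed.

(** The leading monomial of a product of two nonzero normal forms is the sum of their leading
    monomials, both outside [M], so it cannot lie in [M]. *)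
Lemma mon_ideal_prime M : upclosed M -> ~~ M 0%MM ->
  (forall u v, M (u + v)%MM -> M u || M v) -> is_prime_ideal (mon_ideal M).
Proof.
move=> upM M0 Mprime; split; first exact: mon_ideal_ideal.
  by move/(_ 0%MM); rewrite msupp1 mem_seq1 eqxx (negPf M0) => /(_ isT).
move=> f g /(mon_ideal_outM _ _ upM); rewrite mulrC => /(mon_ideal_outM _ _ upM).
have outpart0 h : outpart M h = 0 -> mon_ideal M h.
  by move=> h0; rewrite -[h]subr0 -h0; apply: outpartB.
have [/outpart0|f0] := eqVneq (outpart M f) 0; first by left.
have [/outpart0|g0] := eqVneq (outpart M g) 0; first by right.
move/(_ (mlead (outpart M g * outpart M f))).
rewrite mlead_supp ?mulf_neq0 // mleadM // => /(_ isT)/Mprime.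
have := mlead_supp f0; have := mlead_supp g0.
by rewrite !msupp_outpart => /andP[/negPf-> _] /andP[/negPf-> _].
Qed.

Lemma mnm1_le u j : u j != 0%N -> (U_(j) <= u)%MM.
Proof.
by move=> uj; apply/mnm_lepP=> i; rewrite mnm1E; case: eqVneq => // <-; rewrite lt0n.
Qed.

Definition hits A : pred 'X_{1..n} := fun u => [exists j in A, u j != 0%N].

Lemma hitsD A u v : hits A (u + v)%MM = hits A u || hits A v.
Proof.
apply/existsP/orP=> [[j /andP[jA]]|[|]/existsP[j /andP[jA uj]]].
- rewrite mnmDE addn_eq0 negb_and.
  by case/orP=> ?; [left | right]; apply/existsP; exists j; rewrite jA.
- by exists j; rewrite jA mnmDE addn_eq0 negb_and uj.
- by exists j; rewrite jA mnmDE addn_eq0 negb_and uj orbT.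
Qed.

Lemma hits_upclosed A : upclosed (hits A).
Proof. by move=> u v Au; rewrite hitsD Au. Qed.

Lemma hits1 A j : hits A U_(j)%MM = (j \in A).
Proof.
apply/existsP/idP=> [[i /andP[iA]]|jA]; last by exists j; rewrite jA mnm1E eqxx.
by rewrite mnm1E; have [->|] := eqVneq j i.
Qed.

Lemma var_primeE A : ideal_eq (var_prime K A) (mon_ideal (hits A)).
Proof.
move=> f; split.
  apply: ideal_gen_min; first exact/mon_ideal_ideal/hits_upclosed.
  by move=> g [j jA ->]; apply/mon_idealX; rewrite hits1.
apply: mon_ideal_min; first exact: ideal_gen_ideal.
move=> u /existsP[j /andP[jA uj]].
rewrite -(submK (mnm1_le uj)) mpolyXD; have [_ _] := ideal_gen_ideal
  (fun f : {mpoly K[n]} => exists2 j, j \in A & f = 'X_j).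
by apply; apply: ideal_genW; exists j.
Qed.

Lemma var_prime_prime A : is_prime_ideal (var_prime K A).
Proof.
apply: is_prime_ideal_eq (ideal_eq_sym (var_primeE A)) _.
apply: mon_ideal_prime; first exact: hits_upclosed.
  by apply/existsP=> -[j]; rewrite mnm0E eqxx andbF.
by move=> u v; rewrite hitsD.
Qed.

Lemma var_prime_inj A B : ideal_eq (var_prime K A) (var_prime K B) -> A = B.
Proof.
move=> AB; apply/setP=> j.
have var_primeX C : var_prime K C 'X_j <-> j \in C.
  by rewrite var_primeE mon_idealX hits1.
by apply/idP/idP; rewrite -var_primeX; [rewrite AB|rewrite -AB]; rewrite var_primeX.
Qed.

(* Induction on the number of terms of f outside the ideal: if the leading
   monomial of some g in P is not in P, multiplying f by it does not change the
   colon ideal but lowers that number. *)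
Lemma colon_prime_monomial M P f : upclosed M -> is_prime_ideal P ->
  ideal_eq P (ideal_colon (mon_ideal M) f) ->
  forall g u, P g -> u \in msupp g -> P 'X_[u].
Proof.
move=> upM [idP P1 PX]; have [_ _ PM] := idP.
have [N] := ubnP (size (msupp (outpart M f))).
elim: N f => // N IHN f leN Pf g.
have outP h : P h <-> mon_ideal M (h * outpart M f).
  by rewrite Pf /ideal_colon mon_ideal_outM.
have f0 : outpart M f != 0.
  apply/eqP=> f0; apply: P1; apply/outP; rewrite f0 mulr0.
  by case: (mon_ideal_ideal upM).
have [L] := ubnP (size (msupp g)).
elim: L g => // L IHL g leL u Pg ug.
have g0 : g != 0 by apply: contraTneq ug => ->; rewrite msupp0.
(* A double negation suffices: through [outP], membership in [P] is a family of boolean statements,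
   hence stable under double negation. *)
have nPX : ~ ~ P 'X_[mlead g].
  move=> nPg; apply: (nPg); apply: (IHN ('X_[mlead g] * outpart M f) _ _ g);
    rewrite ?mlead_supp //.
    set q := _ * _; suff : (size (msupp (outpart M q)) < size (msupp (outpart M f)))%N.
      by move=> /leq_trans; apply; rewrite -ltnS.
    (* The product [g * outpart M f] lies in the ideal, hence so does its leading monomial.
       Multiplying by the leading monomial of [g] thus pushes at least one term of [outpart M f]
       into the ideal. *)
    have : M (mlead g + mlead (outpart M f))%MM.
      by rewrite -mleadM //; apply: (iffLR (outP g) Pg);
         rewrite mlead_supp ?mulf_neq0.
    move=> Mgf; have -> : size (msupp (outpart M f)) =
        (size (rem (mlead (outpart M f)) (msupp (outpart M f)))).+1.
      by rewrite size_rem ?mlead_supp // prednK // -has_predT;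
         apply/hasP; exists (mlead (outpart M f)); rewrite ?mlead_supp.
    rewrite ltnS -(size_map (fun v => mlead g + v)%MM (rem _ _)).
    apply: uniq_leq_size; first exact: msupp_uniq.
    move=> v; rewrite msupp_outpart /q mulrC => /andP[Mv].
    rewrite (perm_mem (msuppMX _ _)) => /mapP[w wf vE]; apply/mapP.
    exists w; last by [].
    rewrite mem_rem_uniq ?msupp_uniq // inE wf andbT.
    by apply: contraNneq Mv => wE; rewrite vE wE.
  move=> h; rewrite /ideal_colon mulrA -outP.
  split=> [Ph|/PX[]//]; first by rewrite mulrC; apply: PM.
suff PXg : P 'X_[mlead g].
  have [->//|neu] := eqVneq u (mlead g).
  (* Subtracting the leading term stays in [P] and keeps [u] in the support, so the induction on the
     number of terms of [g] applies. *)
  pose g' := g - g@_(mlead g) *: 'X_[mlead g].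
  apply: (IHL g'); last 2 first.
  - by apply: (is_idealB idP) => //; rewrite -mul_mpolyC; apply: PM.
  - rewrite mcoeff_msupp mcoeffB mcoeffZ mcoeffX [_ == u]eq_sym (negPf neu) mulr0 subr0.
    by rewrite -mcoeff_msupp.
  rewrite (perm_size (msupp_rem _ _)) size_rem ?mlead_supp //.
  by case: (msupp g) leL ug => //= a s; rewrite !ltnS.
move: nPX; rewrite outP => nPX v vs; apply/negPn/negP=> Mv.
by apply: nPX => /(_ v vs); apply/negP.
Qed.

(** On monomials, [P] contains the intersection of the colons by the finitely many terms of [f]. As
    [P] is prime, it already contains one of these colons; the induction discards a term whose colon
    is not inside [P]. *)
Lemma colon_prime_witness M P f : upclosed M -> is_prime_ideal P ->
  ideal_eq P (ideal_colon (mon_ideal M) f) ->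
  exists w, forall u, P 'X_[u] <-> M (u + w)%MM.
Proof.
move=> upM prP Pf; have [[P0 PD PM] P1 PX] := prP.
have PXM u w : w \in msupp f -> P 'X_[u] -> M (u + w)%MM.
  move=> wf /Pf Mf; apply: Mf; rewrite mulrC (perm_mem (msuppMX _ _)).
  by apply/mapP; exists w.
suff [w wf Mw] : exists2 w, w \in msupp f & forall u, M (u + w)%MM -> P 'X_[u].
  by exists w => u; split; [apply: PXM | apply: Mw].
have Pall u : {in msupp f, forall w, M (u + w)%MM} -> P 'X_[u].
  move=> Mu; apply/Pf; rewrite /ideal_colon => v.
  by rewrite mulrC (perm_mem (msuppMX _ _)) => /mapP[w /Mu Mw ->].
elim: (msupp f) Pall => [|w s IHs] Pall.
  by case: P1; rewrite -mpolyX0; apply: Pall.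
have [/not_all_ex_not[u nMu]|] :=
    classic (~ forall u, M (u + w)%MM -> P 'X_[u]); last first.
  by move/NNPP=> Mw; exists w; rewrite ?mem_head.
have [Mu nPu] := imply_to_and _ _ nMu.
case: IHs => [v Mv|w' w's Mw']; last by exists w'; rewrite // inE w's orbT.
suff /PX[] : P ('X_[u] * 'X_[v]) by [].
rewrite -mpolyXD; apply: Pall => w'; rewrite inE => /orP[/eqP->|w's].
  by rewrite -addmA (addmC v) addmA; apply: upM.
by rewrite -addmA addmC; apply: upM; apply: Mv.
Qed.

(** Since [P] is prime, a monomial of [P] has a variable factor in [P]; so [P] is generated by the
    variables that multiply the witness monomial into the ideal. *)
Lemma Ass_monomial M P : upclosed M ->
  Ass (mon_ideal M) P <-> exists A w,
    ideal_eq P (var_prime K A) /\ (forall u, M (u + w)%MM = hits A u).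
Proof.
move=> upM; split=> [[prP [f Pf]]|[A [w [PA Mw]]]].
  have Pmon := colon_prime_monomial upM prP Pf.
  have [w Pw] := colon_prime_witness upM prP Pf.
  have [[P0 PD PM] P1 PX] := prP.
  pose A := [set j : 'I_n | M (U_(j) + w)%MM].
  have PhitsP u : P 'X_[u] <-> hits A u.
    split=> [|/existsP[j]]; last first.
      rewrite inE => /andP[/Pw Pj uj].
      by rewrite -(submK (mnm1_le uj)) mpolyXD; apply: PM.
    have [N] := ubnP (mdeg u); elim: N u => // N IHN u leN Pu.
    have [u0|] := boolP (u == 0%MM); first by case: P1; rewrite -mpolyX0 -(eqP u0).
    rewrite -mdeg_eq0 mdegE sum_nat_eq0 => /forallPn[/= j uj].
    move: leN Pu; rewrite -(submK (mnm1_le uj)) mpolyXD mdegD mdeg1 addn1 ltnS hitsD.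
    by move=> leN /PX[/IHN->//|/Pw Mj]; rewrite hits1 inE Mj orbT.
  exists A, w; split; last first.
    by move=> u; apply/idP/idP; [move/Pw/PhitsP | move/PhitsP/Pw].
  apply: ideal_eq_trans (ideal_eq_sym (var_primeE A)) => f'.
  split=> [Pf' u uf'|]; first exact/PhitsP/(Pmon f').
  by apply: mon_ideal_min => // u /PhitsP.
split; first exact: is_prime_ideal_eq (ideal_eq_sym PA) (var_prime_prime A).
exists 'X_[w]; apply: (ideal_eq_trans PA).
apply: (ideal_eq_trans (var_primeE A)) => f; rewrite /ideal_colon.
split=> [fA u|fM u uf].
  by rewrite (perm_mem (msuppMX _ _)) => /mapP[v /fA vA ->]; rewrite addmC Mw.
rewrite -Mw; apply: fM; rewrite (perm_mem (msuppMX _ _)) addmC.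
by apply/mapP; exists u.
Qed.

End MonomialIdeals.

(** * Partial degrees of exponents *)

Section Weights.
Variable n : nat.
Implicit Types (u v : 'X_{1..n}) (A B : {set 'I_n}).

Definition weight u A := \sum_(j in A) u j.

Lemma weightD u v A : weight (u + v)%MM A = weight u A + weight v A.
Proof. by rewrite /weight -big_split; apply: eq_bigr => j _; rewrite mnmDE. Qed.

Lemma weight1 j A : weight U_(j)%MM A = (j \in A).
Proof.
rewrite /weight; case: (boolP (j \in A)) => jA.
  rewrite (bigD1 j) //= mnm1E eqxx big1 // => i /andP[_ ij].
  by rewrite mnm1E eq_sym (negPf ij).
by rewrite big1 // => i iA; rewrite mnm1E; case: eqP => // ji; rewrite ji iA in jA.
Qed.

Lemma leq_weight u j A : j \in A -> u j <= weight u A.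
Proof. by move=> jA; rewrite /weight (bigD1 j) //= leq_addr. Qed.

Lemma leq_weight_sub u A B : A \subset B -> weight u A <= weight u B.
Proof.
by move=> /setIidPr AB; rewrite /weight [leqRHS](big_setID A) /= AB leq_addr.
Qed.

Lemma weightU u A B : [disjoint A & B] -> weight u (A :|: B) = weight u A + weight u B.
Proof. by move=> AB; rewrite /weight -bigU //; apply: eq_bigl => j; rewrite inE. Qed.

Lemma weight0 u : weight u set0 = 0.
Proof. by rewrite /weight big_set0. Qed.

End Weights.

(** * Associated primes of an intersection of powers of monomial primes *)

Section PrimePowerIntersection.
Variables (K : fieldType) (n : nat) (T : finType).
Variables (A : T -> {set 'I_n}) (e : T -> nat).
Implicit Types (u v w : 'X_{1..n}) (t : T).

(* The monomials of the intersection of the powers P_(A t)^(e t). *)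
Definition in_all_powers : pred 'X_{1..n} :=
  fun u => [forall t, e t <= weight u (A t)].

(** The socle condition after localizing at P_(A t). Several indices may share the set [A t]; the
    boolean summand lets all their bounds be missed by one, as any variable of [A t] repairs them
    together. *)
Definition critical t : Prop :=
  exists w, e t = (weight w (A t)).+1 /\
    forall t', A t' \subset A t -> e t' <= weight w (A t') + (A t' == A t).

Lemma in_all_powers_upclosed : upclosed in_all_powers.
Proof.
move=> u v /forallP Mu; apply/forallP=> t; rewrite weightD.
exact: leq_trans (Mu t) (leq_addr _ _).
Qed.

(* Multiplying by a large power of the variables outside A t localizes at
   P_(A t). *)
Lemma Ass_in_all_powers (P : {mpoly K[n]} -> Prop) :
  (forall t, 0 < e t -> A t != set0) ->
  Ass (mon_ideal in_all_powers) P <->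
  exists t, ideal_eq P (var_prime K (A t)) /\ critical t.
Proof.
move=> A0; pose N := \sum_t e t.
have leN t : e t <= N by rewrite /N (bigD1 t) //= leq_addr.
rewrite (Ass_monomial _ in_all_powers_upclosed).
pose far (B : {set 'I_n}) : 'X_{1..n} := [multinom if j \in B then 0 else N | j < n].
have far_in (B C : {set 'I_n}) : C \subset B -> weight (far B) C = 0.
  by move=> /subsetP CB; rewrite /weight big1 // => j /CB jB; rewrite mnmE jB.
have far_out (B C : {set 'I_n}) : ~~ (C \subset B) -> N <= weight (far B) C.
  case/subsetPn=> j jC jB; apply: leq_trans (leq_weight _ jC).
  by rewrite mnmE (negPf jB).
split=> [[B [w [PB Mw]]]|[t [PA [w [et crit]]]]].
  have : ~~ in_all_powers (far B + w)%MM.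
    rewrite Mw; apply/existsP=> -[j /andP[jB]].
    by rewrite mnmE jB.
  case/forallPn=> t; rewrite -ltnNge weightD => lt_et.
  have AB : A t \subset B.
    apply: contraLR lt_et => /far_out Nle; rewrite -leqNgt.
    by apply: leq_trans (leN t) (leq_trans Nle (leq_addr _ _)).
  rewrite far_in // add0n in lt_et.
  have Mw1 j t' : j \in B -> e t' <= (j \in A t') + weight w (A t').
    move=> jB; have /forallP/(_ t') : in_all_powers (U_(j) + w)%MM.
      by rewrite Mw hits1.
    by rewrite weightD weight1.
  (* A variable of [B] outside [A t] would leave the bound of [t] violated, although it multiplies
     the witness into the ideal. *)
  have AtB : A t = B.
    apply/eqP; rewrite eqEsubset AB; apply/subsetP=> j jB.
    by have := Mw1 j t jB; case: (j \in A t) => //; rewrite add0n leqNgt lt_et.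
  exists t; rewrite AtB; split=> //; exists w; rewrite AtB.
  have /set0Pn[j jB] : B != set0.
    by rewrite -AtB A0 //; apply: leq_ltn_trans lt_et.
  split=> [|t' At'].
    apply/eqP; rewrite eqn_leq -{2}AtB lt_et andbT.
    by have := Mw1 j t jB; rewrite AtB jB add1n.
  case: eqP => [AB'|/eqP neAB'].
    by have := Mw1 j t' jB; rewrite AB' jB addnC.
  have /set0Pn[i] : B :\: A t' != set0.
    by rewrite setD_eq0; apply: contra neAB' => BA; rewrite eqEsubset At'.
  by rewrite inE => /andP[iA' iB]; have := Mw1 i t' iB; rewrite (negPf iA') addnC.
exists (A t), (w + far (A t))%MM; split=> // u.
apply/forallP/idP=> [/(_ t)|/existsP[j /andP[jA uj]] t'].
  rewrite !weightD far_in // addn0 et; apply: contraLR.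
  move=> /existsPn nhit; rewrite -leqNgt -subn_eq0 addnK.
  rewrite /weight sum_nat_eq0; apply/forallP=> j; apply/implyP=> jA.
  by have := nhit j; rewrite jA negbK.
rewrite !weightD; have [A'|/far_out] := boolP (A t' \subset A t); last first.
  by move=> Nle; apply: leq_trans (leN t') _; rewrite addnA (leq_trans Nle) ?leq_addl.
apply: leq_trans (crit t' A') _; rewrite addnCA leq_add2l far_in // addn0.
by case: eqP => // ->; apply: leq_trans (leq_weight _ jA); rewrite lt0n.
Qed.

End PrimePowerIntersection.

(** * Exponents described by their cumulative sums *)

Section CumulativeSums.
Variable n : nat.
Implicit Types (u v : 'X_{1..n}) (U : nat -> nat).

Definition csum u i := weight u (intv n 1 i).

Lemma in_intv s t (j : 'I_n) : (j \in intv n s t) = (s <= j.+1 <= t).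
Proof. by rewrite inE. Qed.

Lemma intv0 s t : t < s -> intv n s t = set0.
Proof. by move=> ts; apply/setP=> j; rewrite in_intv inE; lia. Qed.

Lemma sum_intv (F : nat -> nat) s t : t <= n ->
  \sum_(s <= l < t) F l = \sum_(l in intv n s.+1 t) F l.
Proof.
move=> tn; rewrite (big_nat_widen _ _ _ _ _ tn) (big_nat_widenl _ 0) // big_mkord.
by apply: eq_bigl => l; rewrite in_intv andbC.
Qed.

Lemma csum0 u : csum u 0 = 0.
Proof. by rewrite /csum intv0 // weight0. Qed.

Lemma csum_intv u i j : i <= j -> csum u j = csum u i + weight u (intv n i.+1 j).
Proof.
move=> ij; rewrite /csum -weightU; last first.
  rewrite -setI_eq0; apply/eqP/setP=> l; rewrite !inE; lia.
by congr weight; apply/setP=> l; rewrite !inE; lia.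
Qed.

Lemma csumS u (l : 'I_n) : csum u l.+1 = csum u l + u l.
Proof.
rewrite (csum_intv u (leqnSn l)); congr (_ + _).
rewrite /weight (big_pred1 l) // => j; rewrite in_intv /= -val_eqE /=; lia.
Qed.

Lemma csum_mdeg u : csum u n = mdeg u.
Proof. by rewrite mdegE; apply: eq_bigl => j; rewrite in_intv ltn_ord. Qed.

Lemma csumD u v i : csum (u + v)%MM i = csum u i + csum v i.
Proof. exact: weightD. Qed.

Lemma csum_homo u i j : i <= j -> csum u i <= csum u j.
Proof. by move=> /(csum_intv u)->; rewrite leq_addr. Qed.

(** The exponent with cumulative sums [U]: the truncated subtraction is exact once [U] is
    nondecreasing with [U 0 = 0]. *)
Definition increments U : 'X_{1..n} := [multinom U j.+1 - U j | j < n].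

Lemma csum_increments U i : U 0 = 0 -> (forall l, l < n -> U l <= U l.+1) ->
  i <= n -> csum (increments U) i = U i.
Proof.
move=> U0 Uhomo; elim: i => [|i IHi] lt_in; first by rewrite csum0.
rewrite (csumS _ (Ordinal lt_in)) /= IHi 1?ltnW // mnmE /=.
exact/subnKC/Uhomo.
Qed.

Lemma weight_bsum_le u (c : nat -> nat) (B : {set 'I_n}) :
  (forall j : 'I_n, j \in B -> u j <= c j.+1) -> weight u B <= bsum c B.
Proof. by move=> uc; apply: leq_sum => j /uc. Qed.

Lemma bsumZ m (c : nat -> nat) (B : {set 'I_n}) :
  bsum (fun i => m * c i) B = m * bsum c B.
Proof. by rewrite /bsum -big_distrr. Qed.

(** Units are added one at a time: while the weight is below the total of the caps, some coordinate
    is below its own cap. *)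
Lemma exists_weight (c : nat -> nat) (B : {set 'I_n}) x : x <= bsum c B ->
  exists u : 'X_{1..n}, [/\ forall j : 'I_n, j \in B -> u j <= c j.+1,
    forall j : 'I_n, j \notin B -> u j = 0 & weight u B = x].
Proof.
elim: x => [|x IHx] le_x.
  exists 0%MM; split=> [j _|j _|]; rewrite ?mnm0E //.
  by rewrite /weight big1 // => j _; rewrite mnm0E.
have [u [uc u0 uB]] := IHx (ltnW le_x).
have /existsP[j /andP[jB uj]] : [exists j in B, u j < c j.+1].
  apply: contraLR le_x => /existsPn nlt; rewrite -leqNgt -uB.
  by apply: leq_sum => j jB; have := nlt j; rewrite jB -leqNgt.
exists (u + U_(j))%MM; split; last by rewrite weightD weight1 jB uB addn1.
  by move=> i iB; rewrite mnmDE mnm1E; case: eqP => [<-|_]; rewrite /= ?addn1 ?addn0 ?uc.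
by move=> i iB; rewrite mnmDE mnm1E u0 //; case: eqP => // ji; rewrite -ji jB in iB.
Qed.

Lemma weight_increments U i j : U 0 = 0 -> (forall l, l < n -> U l <= U l.+1) ->
  i <= j <= n -> weight (increments U) (intv n i.+1 j) = U j - U i.
Proof.
move=> U0 Uhomo /andP[ij jn]; have := csum_intv (increments U) ij.
by rewrite !csum_increments ?(leq_trans ij jn) // => ->; rewrite addKn.
Qed.

Lemma intv_subset i j s t : i < j <= n -> intv n i.+1 j \subset intv n s t ->
  s <= i.+1 /\ j <= t.
Proof.
move=> /andP[ij jn] /subsetP sub; have i_n := leq_trans ij jn.
have := sub (Ordinal i_n); rewrite !in_intv /= ltnSn ij => /(_ isT)/andP[-> _].
case: j ij jn sub => // j ij jn /(_ (Ordinal jn)).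
by rewrite !in_intv /= leqnn ij => /(_ isT)/andP[].
Qed.

End CumulativeSums.

(** * Integer decomposition of level-m exponents *)

Section ScaledExponents.
Variables (n k d : nat) (al be b : nat -> nat).
Implicit Types (u v : 'X_{1..n}).

Definition scaled_exponent m u : Prop :=
  right_plp_exponent k (m * d) (fun i => m * al i) (fun i => m * be i)
    (fun i => m * b i) u.

Lemma scaled_exponentE m u : scaled_exponent m u <->
  [/\ forall i, 1 <= i <= k -> m * al i <= csum u i <= m * be i,
      forall j : 'I_n, k < j.+1 -> u j <= m * b j.+1 & csum u n = m * d].
Proof. by rewrite csum_mdeg. Qed.

Lemma scaled_exponent1 u :
  scaled_exponent 1 u <-> right_plp_exponent k d al be b u.
Proof.
by rewrite /scaled_exponent; split=> -[ab ub ud]; split=> [i /ab|j /ub|];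
  rewrite ?ud ?mul1n.
Qed.

Lemma scaled_exponentD m u v : scaled_exponent 1 u -> scaled_exponent m v ->
  scaled_exponent m.+1 (u + v)%MM.
Proof.
move=> /scaled_exponentE[abu ub ud] /scaled_exponentE[abv vb vd].
apply/scaled_exponentE; split=> [i ik|j kj|].
- by rewrite csumD !mulSn; move: (abu i ik) (abv i ik); rewrite !mul1n; lia.
- by rewrite mnmDE mulSn leq_add ?vb // -[b _]mul1n ub.
- by rewrite csumD ud vd mul1n mulSn.
Qed.

Lemma div_increment_le c x y M : 0 < M -> x <= M * y -> (c + x) %/ M <= c %/ M + y.
Proof.
by move=> M0 xy; rewrite [leqRHS]addnC -divnMDl // leq_div2r //; lia.
Qed.

(** This bounds the entries left after splitting. If [x] exceeds [m * y], the excess is at most [y],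
    so [m.+1] times the excess is at most [x] and the floor grows by at least the excess. *)
Lemma div_increment_ge c x y m :
  x <= m.+1 * y -> c %/ m.+1 + x <= m * y + (c + x) %/ m.+1.
Proof.
move=> xy; have [|lt] := leqP x (m * y).
  by move=> le; rewrite addnC leq_add // leq_div2r // leq_addr.
have -> : x = m * y + (x - m * y) by lia.
set z := x - m * y; rewrite addnCA leq_add2l addnA.
have -> : c %/ m.+1 + z = (z * m.+1 + c) %/ m.+1 by rewrite divnMDl // [RHS]addnC.
by apply: leq_div2r; rewrite /z; nia.
Qed.

(* Integer decomposition: the exponent split off has the cumulative sums
   floor (csum u i / (m + 1)). *)
Lemma scaled_exponent_split m u : k <= n -> scaled_exponent m.+1 u ->
  exists v, [/\ (v <= u)%MM, scaled_exponent 1 v & scaled_exponent m (u - v)%MM].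
Proof.
move=> kn /scaled_exponentE[ab ub ud]; pose U i := csum u i %/ m.+1.
have csumU i : i <= n -> csum (increments n U) i = U i.
  apply: csum_increments => [|l _]; first by rewrite /U csum0.
  by apply: leq_div2r; apply: csum_homo.
have le_vu : (increments n U <= u)%MM.
  apply/mnm_lepP=> j; rewrite mnmE leq_subLR /U csumS.
  by apply: div_increment_le => //; rewrite leq_pmull.
have csumUD i : csum (u - increments n U)%MM i + csum (increments n U) i = csum u i.
  by rewrite -csumD submK.
exists (increments n U); split=> //; apply/scaled_exponentE; split.
- move=> i ik; rewrite csumU; last by lia.
  have /andP[le_al le_be] := ab i ik; rewrite !mul1n.
  rewrite /U leq_divRL // mulnC le_al /= -ltnS ltn_divLR //.
  by rewrite mulSn mulnC; apply: leq_ltn_trans le_be _; rewrite addSn ltnS leq_addl.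
- move=> j kj; rewrite mul1n mnmE leq_subLR /U csumS.
  exact/div_increment_le/ub.
- by rewrite csumU // /U ud mulKn ?mul1n.
- move=> i ik; have := ab i ik; have := csumUD i; rewrite csumU; last by lia.
  (* With c = q(m+1) + r, the remaining cumulative sum is qm + r. If q is below the upper bound y,
     then r <= m gives qm + r <= my; if q = y, then r = 0. *)
  have := divn_eq (csum u i) m.+1; have := ltn_pmod (csum u i) (ltn0Sn m).
  rewrite -/(U i).
  move: (al i) (be i) (csum u i) (U i) (_ %% _) (csum (u - _)%MM i) => x y c q p r.
  by move=> *; nia.
- move=> j kj; rewrite mnmBE mnmE /U csumS.
  have := div_increment_ge (csum u j) (ub j kj); lia.
- have := csumUD n; rewrite csumU // /U ud mulKn //.
  by rewrite mulSn addnC => /addnI.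
Qed.

End ScaledExponents.

(** * Powers of a monomial ideal from a graded family of exponent sets *)

Section MonomialPowers.
Local Open Scope ring_scope.
Variables (K : fieldType) (n : nat).
Variables (E : nat -> 'X_{1..n} -> Prop) (M : nat -> pred 'X_{1..n}).
Hypothesis ME : forall m u, M m u <-> exists2 v, (v <= u)%MM & E m v.
Hypothesis E0 : E 0 0%MM.
Hypothesis ED : forall m u v, E 1 u -> E m v -> E m.+1 (u + v)%MM.
Hypothesis Esplit : forall m u, E m.+1 u ->
  exists v, [/\ (v <= u)%MM, E 1 v & E m (u - v)%MM].

Lemma levels_upclosed m : upclosed (M m).
Proof.
by move=> u v /ME[w wu Ew]; apply/ME; exists w => //; apply: lepm_trans wu (lem_addr _ _).
Qed.

(** [ED] places products of generators in the next level; [Esplit] peels a generator off a level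
    exponent and so gives the converse inclusion. *)
Lemma ideal_exp_monomial m :
  ideal_eq (ideal_exp (ideal_gen (fun f : {mpoly K[n]} =>
                         exists2 u, E 1 u & f = 'X_[u])) m)
           (mon_ideal (M m)).
Proof.
set I := ideal_gen _; have idI : is_ideal I by apply: ideal_gen_ideal.
elim: m => [|m IHm] f /=.
  by split=> // _ u _; apply/ME; exists 0%MM => //; apply/mnm_lepP=> i; rewrite mnm0E.
have upM := @levels_upclosed.
split.
  apply: ideal_gen_min; first exact: mon_ideal_ideal.
  move=> _ [x [y [Ix /IHm My ->]]].
  have Mx : mon_ideal (M 1) x.
    move: Ix; apply: ideal_gen_min; first exact: mon_ideal_ideal.
    by move=> _ [u Eu ->]; apply/mon_idealX/ME; exists u => //; apply: lepm_refl.
  move=> u /msuppM_le/allpairsP[[v w] /= [/Mx/ME[v' v'v Ev'] /My/ME[w' w'w Ew'] ->]].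
  apply/ME; exists (v' + w')%MM; last exact: ED.
  by apply/mnm_lepP=> j; rewrite !mnmDE leq_add //; apply/mnm_lepP: j.
apply: mon_ideal_min; first exact: ideal_gen_ideal.
move=> u /ME[v vu /Esplit[w [wv Ew Evw]]].
have -> : u = (w + (u - w))%MM by rewrite addmC submK //; apply: lepm_trans vu.
rewrite mpolyXD; apply: ideal_genW; exists 'X_[w], 'X_[u - w]; split=> //.
  by apply: ideal_genW; exists w.
apply/IHm/mon_idealX/ME; exists (v - w)%MM => //.
by apply/mnm_lepP=> j; rewrite !mnmBE leq_sub2r //; move/mnm_lepP: vu.
Qed.

End MonomialPowers.

(** * Linear constraints for the monomials of the powers *)

Section Reduced.
Variables (n k d : nat) (al be b : nat -> nat).
Implicit Types (u v w : 'X_{1..n}).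

Local Notation tail := (intv n k.+1 n).

(** Both bounds start with the value 0 at index 0, so intervals beginning at 1 are no special case.
    By [red_d_al], the lower bound at [k] already covers the part of the degree that the tail cannot
    absorb. *)
Record reduced_plp : Prop := ReducedPLP {
  red_kn : k <= n;
  red_al0 : al 0 = 0;
  red_be0 : be 0 = 0;
  red_al_mono : forall i j, i <= j <= k -> al i <= al j;
  red_be_mono : forall i j, i <= j <= k -> be i <= be j;
  red_al_be : forall i, 0 < i <= k -> al i < be i;
  red_be_d : be k <= d;
  red_b_gt0 : forall i, k < i <= n -> 0 < b i;
  red_d_al : d <= al k + bsum b tail;
  red_d_be : d < be k + bsum b tail
}.

Hypothesis red : reduced_plp.

(* inl (j, i) is the constraint u_(j+1) + ... + u_i >= al i - be j, and inr (j, C)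
   the constraint u_(j+1) + ... + u_k + u(C) >= d - be j - b(tail - C). *)
Definition constraint : finType :=
  (('I_k.+1 * 'I_k.+1) + ('I_k.+1 * {set 'I_n}))%type.

Definition constraint_set (t : constraint) : {set 'I_n} :=
  match t with
  | inl (j, i) => intv n j.+1 i
  | inr (j, C) => intv n j.+1 k :|: (C :&: tail)
  end.

Definition constraint_bound m (t : constraint) : nat :=
  match t with
  | inl (j, i) => m * (al i - be j)
  | inr (j, C) => m * (d - (be j + bsum b (tail :\: C)))
  end.

Definition plp_monomial m := in_all_powers constraint_set (constraint_bound m).

Lemma red_al_le_be i : i <= k -> al i <= be i.
Proof.
case: i => [|i] ik; first by rewrite red_al0 // red_be0.
by apply/ltnW/(red_al_be red).
Qed.

Lemma bsumDC (C : {set 'I_n}) : bsum b tail = bsum b (C :&: tail) + bsum b (tail :\: C).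
Proof. by rewrite setIC; exact: big_setID. Qed.

(** Each constraint is the difference of a lower bound on a cumulative sum, or the total degree, and
    the upper bound at [j]; tail variables outside [C] contribute at most their caps. *)
Lemma scaled_exponent_plp_monomial m u v :
  (v <= u)%MM -> scaled_exponent k d al be b m v -> plp_monomial m u.
Proof.
move=> vu /scaled_exponentE[abv vb vd].
apply: (upclosed_le (@in_all_powers_upclosed _ _ _ _) vu).
have kn := red_kn red.
have le_be j : j <= k -> csum v j <= m * be j.
  case: j => [|j] jk; first by rewrite csum0.
  by have /andP[] := abv j.+1 jk.
apply/forallP=> -[[j i]|[j C]] /=; rewrite mulnBr leq_subLR.
  have jk := ltn_ord j; have ik := ltn_ord i.
  have [ji|ij] := leqP j i; last first.
    apply: leq_trans (leq_addr _ _); rewrite leq_mul2l.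
    apply/orP; right; apply: leq_trans (red_al_le_be _) _ => //.
    by apply: (red_be_mono red); lia.
  apply: leq_trans (_ : csum v i <= _).
    case: (posnP i) => [->|i0]; first by rewrite (red_al0 red) muln0.
    by have /andP[] : m * al i <= csum v i <= m * be i by apply: abv; lia.
  by rewrite (csum_intv v ji) leq_add2r le_be.
rewrite weightU; last first.
  by rewrite -setI_eq0; apply/eqP/setP=> l; rewrite !inE; have := ltn_ord j; lia.
have jk : j <= k by rewrite -ltnS.
rewrite mulnDr -vd (csum_intv v kn) (csum_intv v jk).
have -> : weight v tail = weight v (C :&: tail) + weight v (tail :\: C).
  by rewrite setIC; exact: big_setID.
have : weight v (tail :\: C) <= m * bsum b (tail :\: C).
  rewrite -bsumZ; apply: weight_bsum_le => l.
  by rewrite !inE => /and3P[_ kl _]; apply: vb.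
have := le_be j jk; lia.
Qed.

(** The greedy cumulative sums [U] are the largest ones that respect the upper bounds and have
    increments at most those of [u]; the constraints say that they also reach the lower bounds. *)
Lemma plp_monomial_scaled_exponent m u : plp_monomial m u ->
  exists2 v, (v <= u)%MM & scaled_exponent k d al be b m v.
Proof.
move=> /forallP Mu; have kn := red_kn red.
pose cap i := if i <= k then m * be i else m * d.
(* The available increment at the 0-based position [l]: tail entries are truncated at their caps,
   and positions from [n] on get the default 0. *)
pose x (l : nat) := if insub l is Some j then
    if l < k then u (j : 'I_n) else minn (u j) (m * b l.+1) else 0.
have xE (j : 'I_n) : x j = if j < k then u j else minn (u j) (m * b j.+1).
  by rewrite /x insubT //= => jn; congr (if _ then u _ else minn (u _) _); apply: val_inj.
pose U := fix U i := if i is i'.+1 then minn (cap i) (U i' + x i') else 0.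
have US i : U i.+1 = minn (cap i.+1) (U i + x i) by [].
have cap_mono i : cap i <= cap i.+1.
  rewrite /cap; case: (ltngtP i k) => ik; rewrite ?leqnn //.
    by rewrite leq_mul2l (red_be_mono red) ?orbT; lia.
  by rewrite ik leq_mul2l (red_be_d red) orbT.
have Ucap i : U i <= cap i by case: i => // i; rewrite US geq_minl.
have Umono i : U i <= U i.+1.
  by rewrite US leq_min leq_addr andbT (leq_trans (Ucap i)).
have Ux i : U i.+1 - U i <= x i by rewrite leq_subLR US geq_minr.
(* Unrolling the recursion, [U i] is the minimum over j <= i of [cap j] plus the increments from [j]
   to [i]; only the lower estimate is needed. *)
have Uge y i : (forall j, j <= i -> y <= cap j + \sum_(j <= l < i) x l) -> y <= U i.
  elim: i y => [|i IHi] y Hy.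
    by have := Hy 0 isT; rewrite big_geq // addn0 /cap /= (red_be0 red) muln0.
  rewrite US leq_min; apply/andP; split.
    by have := Hy i.+1 (leqnn _); rewrite big_geq // addn0.
  rewrite addnC -leq_subLR; apply: IHi => j ji; rewrite leq_subLR addnC -addnA.
  by rewrite -big_nat_recr // Hy // ltnW.
(* The positions where truncation is inactive. Off [C] the available tail increment is the full cap,
   so this [C] yields exactly the constraint needed for the total degree. *)
pose C := [set l : 'I_n | u l < m * b l.+1].
have sumx j i : i <= k -> \sum_(j <= l < i) x l = weight u (intv n j.+1 i).
  move=> ik; rewrite (sum_intv _ _ (leq_trans ik kn)); apply: eq_bigr => l.
  by rewrite in_intv xE => /andP[_ li]; rewrite (leq_trans li).
have sumt : \sum_(k <= l < n) x l = weight u (C :&: tail) + m * bsum b (tail :\: C).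
  rewrite (sum_intv _ _ (leqnn n)) (big_setID C) setIC -bsumZ.
  congr (_ + _); apply: eq_bigr => l; rewrite !inE xE; first last.
    by case: ltnP => // le /and3P[_ kl _]; rewrite ltnNge -ltnS kl.
  case/and3P=> /ltnW lt kl _; rewrite ltnNge -ltnS kl; exact/minn_idPl.
exists (increments n U).
  apply/mnm_lepP=> j; rewrite mnmE; apply: leq_trans (Ux j) _.
  by rewrite xE; case: ifP => // _; apply: geq_minl.
apply/scaled_exponentE; split=> [i /andP[i0 ik]|j kj|].
- rewrite csum_increments ?(leq_trans ik) //; apply/andP; split; last first.
    by have := Ucap i; rewrite /cap ik.
  apply: Uge => j ji; rewrite /cap (leq_trans ji ik) sumx // -leq_subLR -mulnBr.
  have ltk l : l <= k -> l < k.+1 by [].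
  exact: (Mu (inl (Ordinal (ltk _ (leq_trans ji ik)), Ordinal (ltk _ ik)))).
- rewrite mnmE; apply: leq_trans (Ux j) _.
  by rewrite xE; case: (ltnP j k) => [|_]; [lia | apply: geq_minr].
- rewrite csum_increments //; apply/eqP; rewrite eqn_leq; apply/andP; split.
    apply: leq_trans (Ucap n) _; rewrite /cap; case: ifP => // nk.
    by rewrite leq_mul2l (leq_trans _ (red_be_d red)) ?orbT // (red_be_mono red) // nk leqnn.
  apply: Uge => j jn; rewrite /cap; case: (leqP j k) => [jk|_]; last exact: leq_addr.
  rewrite (big_cat_nat jk kn) sumx //= sumt.
  have ltk l : l <= k -> l < k.+1 by [].
  have := Mu (inr (Ordinal (ltk _ jk), C)) => /=.
  rewrite mulnBr leq_subLR mulnDr weightU.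
    by rewrite -addnA [m * bsum _ _ + _]addnC -addnA.
  by rewrite -setI_eq0; apply/eqP/setP=> l; rewrite !inE; lia.
Qed.


(** * Numerical conditions for a constraint to be critical *)

Local Notation critical_at m := (critical constraint_set (constraint_bound m)).

Lemma tail_disjoint j (B : {set 'I_n}) : B \subset tail -> [disjoint intv n j k & B].
Proof.
move=> /subsetP Bt; rewrite -setI_eq0; apply/eqP/setP=> l; rewrite !inE.
by apply/negbTE; rewrite negb_and orbC; case: (boolP (l \in B)) => //= /Bt;
   rewrite in_intv; lia.
Qed.

Lemma constraint_set_neq0 m t :
  0 < constraint_bound m t -> constraint_set t != set0.
Proof.
have kn := red_kn red.
case: t => [[j i]|[j C]] /=; rewrite muln_gt0 => /andP[_]; rewrite subn_gt0.
  move=> lt; have jk := ltn_ord j; have ik := ltn_ord i.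
  have ji : j < i.
    rewrite ltnNge; apply: contraL lt => ij; rewrite -leqNgt.
    by apply: leq_trans (red_al_le_be _) (red_be_mono red _); rewrite // ij.
  have jn : j < n by lia.
  by apply/set0Pn; exists (Ordinal jn); rewrite in_intv /= ltnSn.
move=> lt; apply: contraTneq lt => /setP AC0; rewrite -leqNgt.
have CT : tail :\: C = tail.
  apply/setP=> l; have := AC0 l; rewrite !inE.
  by case: (l \in C) => //=; case: (k < l.+1 <= n); rewrite ?orbT.
have [jk|jk] := ltnP j k.
  by have := AC0 (Ordinal (leq_trans jk kn)); rewrite !inE /= ltnSn jk.
have -> : val j = k by apply/eqP; rewrite eqn_leq jk -ltnS ltn_ord.
by rewrite CT ltnW // (red_d_be red).
Qed.

(* A constraint inr with no tail variable is implied by al k + b(tail) >= d. *)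
Lemma constraint_no_tail m (j : 'I_k.+1) (C : {set 'I_n}) : C :&: tail = set0 ->
  constraint_set (inr (j, C)) = constraint_set (inl (j, ord_max)) /\
  constraint_bound m (inr (j, C)) <= constraint_bound m (inl (j, ord_max)).
Proof.
move=> C0; rewrite /= C0 setU0; split=> //; rewrite leq_mul2l.
by have := bsumDC C; rewrite C0 {2}/bsum big_set0; have := red_d_al red; lia.
Qed.

(** The bound of (j, i) is positive and drops strictly when the first or last index is removed; the
    guard exempts singletons, where removal leaves the empty set. *)
Definition interval_condition j i : Prop :=
  be j < al i /\ (j.+1 < i -> be j < be j.+1 /\ al i.-1 < al i).

(** The maximum combines positivity of the bound ([be j]) with its strict drop when [B] is removed
    ([al k]). For j = k there is no first block to remove, hence the guard. *)
Definition tail_condition j (B : {set 'I_n}) : Prop :=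
  bsum b (tail :\: B) + maxn (be j) (al k) < d /\ (j < k -> be j < be j.+1).

Lemma critical_no_tail m (j : 'I_k.+1) (C : {set 'I_n}) : C :&: tail = set0 ->
  critical_at m (inr (j, C)) -> critical_at m (inl (j, ord_max)).
Proof.
move=> C0 [w [wE crit]]; have [setE le_bound] := constraint_no_tail m j C0.
exists w; rewrite -setE; split=> //; apply/eqP; rewrite eqn_leq -{2}wE le_bound andbT.
by have := crit (inl (j, ord_max)); rewrite -setE eqxx addn1; apply.
Qed.

(** The witness meets the bound of the smaller set, and its weight there is at most its weight on
    the larger set, which is one short of its bound. *)
Lemma critical_proper m t t' w :
  constraint_bound m t = (weight w (constraint_set t)).+1 ->
  (forall t', constraint_set t' \subset constraint_set t ->
    constraint_bound m t' <=
      weight w (constraint_set t') + (constraint_set t' == constraint_set t)) ->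
  constraint_set t' \proper constraint_set t ->
  constraint_bound m t' < constraint_bound m t.
Proof.
move=> wE crit; rewrite properEneq => /andP[neq sub].
have := crit _ sub; rewrite (negPf neq) addn0 wE ltnS => /leq_trans; apply.
exact: leq_weight_sub.
Qed.

Lemma critical_interval_condition m (j i : 'I_k.+1) :
  critical_at m (inl (j, i)) -> interval_condition j i.
Proof.
move=> [w [wE crit]]; have kn := red_kn red.
have lt_proper t := critical_proper (t' := t) wE crit.
have := ltn0Sn (weight w (constraint_set (inl (j, i)))); rewrite -wE /=.
rewrite muln_gt0 subn_gt0 => /andP[m0 lt_al]; split=> // ji.
have jk : j.+1 < k.+1 by have := ltn_ord i; lia.
have ik : i.-1 < k.+1 by have := ltn_ord i; lia.
have jn : j < n by lia.
have in' : i.-1 < n by have := ltn_ord i; lia.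
split.
  have := lt_proper (inl (Ordinal jk, i)); rewrite /= ltn_mul2l m0 /=.
  suff -> : intv n j.+2 i \proper intv n j.+1 i by lia.
  apply/properP; split; first by apply/subsetP=> l; rewrite !in_intv; lia.
  by exists (Ordinal jn); rewrite in_intv /=; lia.
have := lt_proper (inl (j, Ordinal ik)); rewrite /= ltn_mul2l m0 /=.
suff -> : intv n j.+1 i.-1 \proper intv n j.+1 i by lia.
apply/properP; split; first by apply/subsetP=> l; rewrite !in_intv; lia.
by exists (Ordinal in'); rewrite in_intv /=; lia.
Qed.

Lemma critical_tail_condition m (j : 'I_k.+1) (C : {set 'I_n}) :
  C :&: tail != set0 -> critical_at m (inr (j, C)) -> tail_condition j C.
Proof.
move=> C0 [w [wE crit]]; have kn := red_kn red.
have lt_proper t := critical_proper (t' := t) wE crit.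
have := ltn0Sn (weight w (constraint_set (inr (j, C)))); rewrite -wE /=.
rewrite muln_gt0 subn_gt0 => /andP[m0 lt_d]; have jk' : j <= k by rewrite -ltnS.
split=> [|jk].
  have := lt_proper (inl (j, ord_max)); rewrite /= ltn_mul2l m0 /=.
  suff -> : intv n j.+1 k \proper intv n j.+1 k :|: C :&: tail by lia.
  rewrite properEneq subsetUl andbT; apply: contraNneq C0 => setE.
  rewrite -(setIidPr (subsetUr (intv n j.+1 k) (C :&: tail))) -setE.
  by rewrite setI_eq0 tail_disjoint // subsetIr.
have jn : j < n by lia.
have := lt_proper (inr (Ordinal (jk : j.+1 < k.+1), C)); rewrite /= ltn_mul2l m0 /=.
suff -> : intv n j.+2 k :|: C :&: tail \proper intv n j.+1 k :|: C :&: tail by lia.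
apply/properP; split; first by apply/setSU/subsetP=> l; rewrite !in_intv; lia.
by exists (Ordinal jn); rewrite !inE /=; lia.
Qed.

Lemma critical_interval m (j i : 'I_k.+1) : 0 < m ->
  interval_condition j i -> critical_at m (inl (j, i)).
Proof.
move=> m0 [lt_al cond]; have kn := red_kn red.
have ik : i <= k by rewrite -ltnS.
have jk : j <= k by rewrite -ltnS.
have ji : j < i.
  rewrite ltnNge; apply: contraL lt_al => ij; rewrite -leqNgt.
  by apply: leq_trans (red_al_le_be _) (red_be_mono red _); rewrite // ij.
(* The least cumulative sums allowed by the constraints (j, l) for l < i, and one unit too few at
   [i]. *)
pose W l := if l < i then m * (al l - be j) else (m * (al i - be j)).-1.
have W0 l : l <= j -> W l = 0.
  move=> lj; rewrite /W (leq_ltn_trans lj) //.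
  have : al l <= be j.
    by apply: leq_trans (red_al_le_be _) (red_be_mono red _); rewrite ?lj // (leq_trans lj).
  by rewrite -subn_eq0 => /eqP->; rewrite muln0.
have W_mono l : W l <= W l.+1.
  rewrite /W; have [li|il] := ltnP l.+1 i.
    rewrite (ltnW li) leq_mul2l leq_sub2r ?orbT // (red_al_mono red) //; lia.
  (* At the last step the missing unit is absorbed by the strict growth of [al l - be j]. *)
  have [li|//] := ltnP l i; have {il li}li : l.+1 = i by lia.
  rewrite -li -ltnS prednK; last by rewrite muln_gt0 m0 subn_gt0 li.
  rewrite ltn_mul2l m0 /=; have [jl|lj] := ltnP j.+1 i.
    by have [_] := cond jl; move: lt_al; rewrite -li /=; lia.
  have {}lj : l <= j by lia.
  have := W0 l lj; rewrite /W -li ltnSn => /eqP; rewrite muln_eq0.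
  by move: lt_al; rewrite -li; lia.
(* The spare unit for l > j compensates the missing unit of [W i] in the constraint (l, i). *)
have W_le l : j <= l < i -> W l + (j < l) <= m * (be l - be j).
  move=> /andP[jl li]; have [{}jl|lj] := ltnP j l; last first.
    by rewrite addn0 W0.
  have lt : al l < be l by apply: (red_al_be red); lia.
  have [lt_be _] : be j < be j.+1 /\ al i.-1 < al i by apply: cond; lia.
  have le_be : be j.+1 <= be l by apply: (red_be_mono red); lia.
  by rewrite /W li addn1 ltn_mul2l m0 /=; lia.
have wE p q : p <= q <= k -> weight (increments n W) (intv n p.+1 q) = W q - W p.
  by move=> pq; apply: weight_increments => //; [apply: W0 | lia].
exists (increments n W).
have crit_inl (p q : 'I_k.+1) : constraint_set (inl (p, q)) \subset intv n j.+1 i ->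
    constraint_bound m (inl (p, q)) <= weight (increments n W) (intv n p.+1 q)
      + (intv n p.+1 q == intv n j.+1 i).
  move=> sub /=; have pk := ltn_ord p; have qk := ltn_ord q.
  have [|lt0] := posnP (constraint_bound m (inl (p, q))); first by move=> /= ->.
  have pq : p < q.
    move: (constraint_set_neq0 lt0); rewrite /= ltnNge; apply: contraNN => qp.
    by apply/eqP/intv0.
  have [] := intv_subset _ sub; first by lia.
  rewrite ltnS => jp qi; rewrite wE; last by lia.
  have Wp : W p + (j < p) <= m * (be p - be j) by apply: W_le; lia.
  have le_be : be j <= be p by apply: (red_be_mono red); lia.
  move: qi; rewrite leq_eqVlt => /orP[/eqP qi|qi].
    move: jp; rewrite leq_eqVlt => /orP[/eqP jp|jp].
      by rewrite -jp qi eqxx (W0 j) // /W ltnn; lia.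
    have -> : W q = (m * (al q - be j)).-1 by rewrite /W qi ltnn.
    by move: Wp (leq_mul (leqnn m) le_be); rewrite jp !mulnBr; lia.
  have -> : W q = m * (al q - be j) by rewrite /W qi.
  by move: Wp (leq_mul (leqnn m) le_be); rewrite !mulnBr; lia.
split=> [|[[p q]|[p C]] sub].
- by rewrite /= wE ?(ltnW ji) // (W0 j) // subn0 /W ltnn prednK // muln_gt0 m0 subn_gt0 lt_al.
- exact: (crit_inl p q sub).
have C0 : C :&: tail = set0.
  apply/setP=> l; rewrite !inE; apply/negbTE/negP=> lC; move/subsetP/(_ l): sub.
  rewrite !inE; lia.
have [setE le_bound] := constraint_no_tail m p C0.
by rewrite setE in sub *; apply: leq_trans le_bound (crit_inl p ord_max sub).
Qed.

(** Staying strictly below positive caps leaves a spare unit as soon as one coordinate is present;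
    this unit is used against the constraints on fewer tail variables. *)
Lemma weight_bsum_pred m (g : 'X_{1..n}) (B : {set 'I_n}) : 0 < m -> B \subset tail ->
  (forall l : 'I_n, l \in B -> g l <= (m * b l.+1).-1) ->
  weight g B + (B != set0) <= m * bsum b B.
Proof.
move=> m0 /subsetP Bt gB; have mb0 l : l \in B -> 0 < m * b (val l).+1.
  by move=> /Bt; rewrite in_intv muln_gt0 m0 => kl; apply: (red_b_gt0 red).
have gb l : l \in B -> g l <= m * b l.+1.
  by move=> lB; apply: leq_trans (gB l lB) (leq_pred _).
have [->|/set0Pn[l lB]] := eqVneq B set0; first by rewrite weight0.
rewrite addn1 -bsumZ /weight /bsum (bigD1 l) //= [ltnRHS](bigD1 l) //= -addSn leq_add //.
  by rewrite -[ltnRHS](prednK (mb0 l lB)) ltnS gB.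
by apply: leq_sum => i /andP[/gb].
Qed.

(** Lowering every cap by one costs at most the number of variables; this is where the level has to
    be at least [n]. *)
Lemma bsum_pred m (B : {set 'I_n}) : n <= m ->
  m * bsum b B <= bsum (fun i => (m * b i).-1) B + m.
Proof.
move=> nm; rewrite -bsumZ.
apply: leq_trans (_ : _ <= bsum (fun i => (m * b i).-1) B + #|B|) _.
  by rewrite -sum1_card /bsum -big_split; apply: leq_sum => l _; rewrite /= addn1 leqSpred.
by rewrite leq_add2l (leq_trans _ nm) // -[leqRHS]card_ord max_card.
Qed.

(** The witness consists of cumulative sums [W] on the first [k] variables and an exponent [g] on
    the tail variables of [C], strictly below the caps, of total weight one short of the bound. *)
Lemma critical_tail m (j : 'I_k.+1) (C : {set 'I_n}) : 0 < m -> n <= m ->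
  C :&: tail != set0 -> tail_condition j C -> critical_at m (inr (j, C)).
Proof.
move=> m0 nm C0 [lt_d lt_be]; have kn := red_kn red.
have jk : j <= k by rewrite -ltnS.
set B := C :&: tail in C0 *; have Bt : B \subset tail by apply: subsetIr.
have bB := bsumDC C; rewrite -/B in bB.
set D := bsum b (tail :\: C) in lt_d bB *.
pose e := m * (d - (be j + D)).
have e0 : 0 < e by rewrite muln_gt0 m0 subn_gt0; lia.
(* The head takes as much of the weight [e.-1] as it can while staying strictly below its upper
   bound. For j = k the head is empty and the predecessor of 0 is 0. *)
pose Y := minn (m * (be k - be j)).-1 e.-1.
have [g [gB g0 gY]] : exists u : 'X_{1..n},
    [/\ forall l : 'I_n, l \in B -> u l <= (m * b l.+1).-1,
        forall l : 'I_n, l \notin B -> u l = 0 & weight u B = e.-1 - Y].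
  apply: (exists_weight (c := fun i => (m * b i).-1)).
  (* The strict inequality [d < be k + bsum b tail], scaled by [m], leaves a surplus [m] that pays
     for the lowered caps. *)
  have : e <= m * (be k - be j) + bsum (fun i => (m * b i).-1) B.
    rewrite -(leq_add2r m) -addnA; apply: leq_trans (leq_add (leqnn _) (bsum_pred B nm)).
    rewrite -mulnDr /e -mulnSr leq_mul2l; have := red_d_be red; lia.
  by rewrite /Y; lia.
pose W l := if l < k then m * (al l - be j) else Y.
have al_Y : m * (al k - be j) <= Y.
  rewrite /Y leq_min; apply/andP; split; last first.
    by rewrite -ltnS (prednK e0) ltn_mul2l m0 /=; lia.
  have [|lt] := leqP (al k) (be j); first by rewrite -subn_eq0 => /eqP->; rewrite muln0.
  have ltk : al k < be k.
    apply: (red_al_be red); rewrite leqnn andbT; have [k0|//] := posnP k.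
    by have := red_al0 red; rewrite -{1}k0; lia.
  by rewrite -ltnS prednK ?muln_gt0 ?ltn_mul2l m0 /=; lia.
have W0 l : l <= j -> W l = 0.
  move=> lj; rewrite /W; case: ltnP => lk.
    have : al l <= be j.
      by apply: leq_trans (red_al_le_be _) (red_be_mono red _); rewrite ?lj // (leq_trans lj).
    by rewrite -subn_eq0 => /eqP->; rewrite muln0.
  rewrite /Y; have <- : k = j by lia.
  by rewrite subnn muln0 /= min0n.
have W_mono l : W l <= W l.+1.
  rewrite /W; have [lk|kl] := ltnP l.+1 k.
    rewrite (ltnW lk) leq_mul2l leq_sub2r ?orbT // (red_al_mono red) //; lia.
  have [lk|//] := ltnP l k; apply: leq_trans al_Y.
  by rewrite leq_mul2l leq_sub2r ?orbT // (red_al_mono red) // leqnn ltnW.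
have W_ge l : l <= k -> m * (al l - be j) <= W l.
  by rewrite leq_eqVlt /W => /orP[/eqP->|->//]; rewrite ltnn.
have W_le l : j <= l <= k -> W l + (j < l) <= m * (be l - be j).
  move=> /andP[jl lk]; have [{}jl|lj] := ltnP j l; last by rewrite addn0 W0.
  have be_jl : be j < be l.
    apply: leq_trans (lt_be _) _; first by lia.
    by apply: (red_be_mono red); lia.
  rewrite addn1 /W; case: (ltnP l k) => [{}lk|kl].
    rewrite ltn_mul2l m0 ltn_sub2r //; apply: (red_al_be red); lia.
  have lkE : l = k by lia.
  rewrite lkE in be_jl *; rewrite -[ltnRHS]prednK; first by rewrite ltnS geq_minl.
  by rewrite muln_gt0 m0 subn_gt0.
have wE p q : p <= q <= k -> weight (increments n W) (intv n p.+1 q) = W q - W p.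
  by move=> pq; apply: weight_increments => //; [apply: W0 | lia].
have wtail (X : {set 'I_n}) : X \subset tail -> weight (increments n W) X = 0.
  move=> /subsetP Xt; rewrite /weight big1 // => l /Xt; rewrite in_intv mnmE /W.
  by rewrite ltnS => /andP[kl _]; rewrite !ltnNge kl (leqW kl) subnn.
have gintv p q : q <= k -> weight g (intv n p q) = 0.
  move=> qk; rewrite /weight big1 // => l; rewrite in_intv => lq.
  by apply: g0; apply/negP=> /(subsetP Bt); rewrite in_intv; lia.
exists (increments n W + g)%MM; split=> [|[[p q]|[p C']] sub].
- rewrite /= -/B -/D weightU ?tail_disjoint // !weightD wE ?jk ?leqnn //.
  rewrite (wtail B) // gintv // addn0 add0n gY (W0 j) // subn0 {1}/W ltnn.
  by rewrite -/e subnKC ?prednK // geq_minr.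
- have [->//|lt0] := posnP (constraint_bound m (inl (p, q))).
  have qk := ltn_ord q; have pq : p < q.
    move: (constraint_set_neq0 lt0); rewrite /= ltnNge; apply: contraNN => qp.
    by apply/eqP/intv0.
  have pn : p < n by lia.
  have jp : j <= p.
    by move/subsetP/(_ (Ordinal pn)): sub; rewrite !inE /=; lia.
  rewrite /= weightD wE ?gintv //; last by lia.
  have le_be : be j <= be p by apply: (red_be_mono red); lia.
  have Wp : W p + (j < p) <= m * (be p - be j) by apply: W_le; lia.
  have Wq : m * (al q - be j) <= W q by apply: W_ge; lia.
  move: Wp Wq (leq_mul (leqnn m) le_be); rewrite !mulnBr.
  move: (W p) (W q) (m * al q) (m * be p) (m * be j); clear -m0; lia.
have [->//|lt0] := posnP (constraint_bound m (inr (p, C'))).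
have pk : p <= k by rewrite -ltnS.
have jp : j <= p.
  have [lt_pk|] := ltnP p k; last by move=> kp; apply: leq_trans kp.
  move/subsetP/(_ (Ordinal (leq_trans lt_pk kn))): sub; rewrite !inE /=; lia.
have B'B : C' :&: tail \subset B.
  apply/subsetP=> l lB'; move/subsetP/(_ l): sub; rewrite /= !inE.
  move: lB'; rewrite !inE; lia.
have B'E : B :&: C' = C' :&: tail.
  rewrite -(setIidPl B'B) /B; apply/setP=> l; rewrite !inE.
  by case: (l \in C); case: (l \in C'); rewrite ?andbF ?andbT ?andbb.
have gE : weight g B = weight g (C' :&: tail) + weight g (B :\: C').
  by rewrite -B'E; exact: big_setID.
have bE : bsum b B = bsum b (C' :&: tail) + bsum b (B :\: C').
  by rewrite -B'E; exact: big_setID.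
have R_le : weight g (B :\: C') + (B :\: C' != set0) <= m * bsum b (B :\: C').
  apply: weight_bsum_pred => // [|l]; first exact: subset_trans (subsetDl _ _) Bt.
  by rewrite inE => /andP[_ lB]; apply: gB.
rewrite /= weightU ?tail_disjoint ?subsetIr // !weightD wE ?pk ?leqnn //.
rewrite (wtail (C' :&: tail)) ?subsetIr // gintv // addn0 add0n.
have -> : W k = Y by rewrite /W ltnn.
have -> : bsum b (tail :\: C') = D + bsum b (B :\: C').
  by have := bsumDC C'; lia.
have Wp : W p + (j < p) <= m * (be p - be j) by apply: W_le; rewrite jp.
have le_be : m * be j <= m * be p by rewrite leq_mul2l (red_be_mono red) ?orbT ?jp.
have le_Y : Y <= e.-1 by apply: geq_minr.
(* The unit missing from the total is recovered from [W_le] if j < p and from [R_le] if [C'] omits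
   part of [B]; otherwise the two sets coincide and the constraint may be missed by one. *)
have Weq : (p == j) && (B :\: C' == set0) <=
    (intv n p.+1 k :|: C' :&: tail == intv n j.+1 k :|: C :&: tail).
  case: eqVneq => // ->; case: eqP => // R0 /=; rewrite -/B -B'E.
  by rewrite -{2}(setID B C') R0 setU0 eqxx.
rewrite -(inj_eq val_inj) /= in Weq.
have W_pk : W p <= Y.
  have -> : Y = W k by rewrite /W ltnn.
  exact: homo_leq leqnn leq_trans W_mono _ _ pk.
move: R_le Wp e0 le_Y gY Weq jp W_pk le_be; rewrite gE /e !mulnBr !mulnDr.
move: (W p) (Y) (weight g _) (weight g _) (m * d) (m * D) (m * be p) (m * be j)
  (m * bsum b _) (_ == intv n j.+1 k :|: _).
clear -m0; case: eqVneq; lia.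
Qed.

(** * Associated primes of the powers for reduced data *)

Lemma plp_power_ideal (K : fieldType) m :
  ideal_eq (ideal_exp (right_plp_ideal K n k d al be b) m)
    (mon_ideal (plp_monomial m)).
Proof.
have Egen : ideal_eq (right_plp_ideal K n k d al be b)
    (ideal_gen (fun f => exists2 u, scaled_exponent k d al be b 1 u & f = 'X_[u])).
  by apply: ideal_gen_eq => f; split=> -[u Eu ->]; exists u => //; apply/scaled_exponent1.
apply: ideal_eq_trans (ideal_exp_eq m Egen) _.
apply: (ideal_exp_monomial (E := scaled_exponent k d al be b)).
- move=> p u; split=> [|[v]]; first exact: plp_monomial_scaled_exponent.
  exact: scaled_exponent_plp_monomial.
- have csum00 i : csum (0%MM : 'X_{1..n}) i = 0.
    by rewrite /csum /weight big1 // => j _; rewrite mnm0E.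
  by apply/scaled_exponentE; split=> [i _|j _|]; rewrite ?csum00 ?mnm0E ?mul0n.
- exact: scaled_exponentD.
- move=> p u; apply: scaled_exponent_split; exact: red_kn red.
Qed.

Lemma Ass_plp_power (K : fieldType) m (P : {mpoly K[n]} -> Prop) :
  Ass (ideal_exp (right_plp_ideal K n k d al be b) m) P <->
  exists t, ideal_eq P (var_prime K (constraint_set t)) /\ critical_at m t.
Proof.
rewrite -(Ass_in_all_powers P (@constraint_set_neq0 m)).
have mE := @plp_power_ideal K m.
split; first exact: Ass_eq mE (@ideal_eq_refl _ P).
exact: Ass_eq (ideal_eq_sym mE) (@ideal_eq_refl _ P).
Qed.

(** The value s = k + 1 gives the empty interval, so the second form also covers the sets contained
    in the tail. *)
Definition plp_prime_set (X : {set 'I_n}) : Prop :=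
  (exists s t, [/\ 1 <= s, s <= t, t <= k, X = intv n s t & interval_condition s.-1 t]) \/
  (exists s (B : {set 'I_n}), [/\ 1 <= s <= k.+1, B != set0, B \subset tail,
     X = intv n s k :|: B & tail_condition s.-1 B]).

Lemma tail_conditionI j (C : {set 'I_n}) :
  tail_condition j (C :&: tail) <-> tail_condition j C.
Proof. by rewrite /tail_condition setDIr setDv setU0. Qed.

Lemma critical_prime_set m t :
  critical_at m t -> plp_prime_set (constraint_set t).
Proof.
have interval (j i : 'I_k.+1) : critical_at m (inl (j, i)) ->
    plp_prime_set (constraint_set (inl (j, i))).
  move=> crit; have cond := critical_interval_condition crit.
  left; exists j.+1, i; split=> //; last by rewrite -ltnS.
  have [lt _] := cond; rewrite ltnNge; apply: contraL lt => ij; rewrite -leqNgt.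
  have jk : j <= k by rewrite -ltnS.
  by apply: leq_trans (red_al_le_be _) (red_be_mono red _); rewrite ?ij ?(leq_trans ij).
case: t => [[j i]|[j C]]; first exact: interval.
have [C0|C0] := eqVneq (C :&: tail) set0 => crit.
  have [-> _] := constraint_no_tail m j C0.
  exact/interval/(critical_no_tail C0).
right; exists j.+1, (C :&: tail); split=> //; first exact: ltn_ord.
  exact: subsetIr.
by apply/tail_conditionI; apply: critical_tail_condition crit.
Qed.

Lemma interval_critical m s t : 0 < m -> 1 <= s -> s <= t -> t <= k ->
  interval_condition s.-1 t ->
  exists2 c, constraint_set c = intv n s t & critical_at m c.
Proof.
case: s => // s m0 _ st tk cond.
have sk : s < k.+1 by lia.
exists (inl (Ordinal sk, Ordinal (tk : t < k.+1))) => //.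
exact: critical_interval.
Qed.

Lemma prime_set_critical m X : 0 < m -> n <= m -> plp_prime_set X ->
  exists2 c, constraint_set c = X & critical_at m c.
Proof.
move=> m0 nm [[s [t [s1 st tk -> cond]]]|]; first exact: interval_critical.
case=> -[|s] [B [/= sk B0 Bt -> cond]] //.
have BE : B :&: tail = B by apply/setIidPl.
exists (inr (Ordinal sk, B)); first by rewrite /= BE.
by apply: critical_tail; rewrite ?BE.
Qed.

Lemma intv_inj s t s' t' : 0 < s -> s <= t -> t <= k -> intv n s t = intv n s' t' ->
  0 < s' -> t' <= k -> s = s' /\ t = t'.
Proof.
case: s s' => // s [//|s'] _ st tk setE _ t'k; have kn := red_kn red.
have [] : s'.+1 <= s.+1 /\ t <= t'.
  by apply: (intv_subset (n := n)); [lia | rewrite setE].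
move=> s's tt'.
have [] : s.+1 <= s'.+1 /\ t' <= t.
  by apply: (intv_subset (n := n)); [lia | rewrite setE].
by lia.
Qed.

Lemma intv_tail s (B : {set 'I_n}) : B \subset tail -> (intv n s k :|: B) :&: tail = B.
Proof.
move=> Bt; rewrite setIUl (setIidPl Bt).
by move: (tail_disjoint s (subxx tail)); rewrite -setI_eq0 => /eqP->; rewrite set0U.
Qed.

Lemma intv_head s t (B : {set 'I_n}) : t <= k -> B \subset tail ->
  (intv n s t :|: B) :\: tail = intv n s t.
Proof.
move=> tk /subsetP Bt; apply/setP=> l; rewrite !inE.
by have := Bt l; rewrite in_intv; case: (l \in B) => [/(_ isT)|_]; lia.
Qed.

Lemma plp_prime_set_interval s t : 1 <= s -> s <= t -> t <= k ->
  plp_prime_set (intv n s t) <-> interval_condition s.-1 t.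
Proof.
move=> s1 st tk; split; last by left; exists s, t.
case=> [[s' [t' [s1' _ tk' /intv_inj]]]|[s' [B [_ B0 Bt setE _]]]].
  by case=> // -> ->.
case/negP: B0; rewrite -(intv_tail s' Bt) -setE.
by apply/eqP/setP=> l; rewrite !inE; lia.
Qed.

(** The pair (s, B) is recovered from the set: [B] is its part in the tail, and the head determines
    [s], being empty only for s = k + 1. *)
Lemma plp_prime_set_tail s (B : {set 'I_n}) :
  1 <= s <= k.+1 -> B != set0 -> B \subset tail ->
  plp_prime_set (intv n s k :|: B) <-> tail_condition s.-1 B.
Proof.
move=> sk B0 Bt; split; last by right; exists s, B.
case=> [[s' [t' [_ _ tk' setE _]]]|[s' [B' [sk' _ Bt' setE]]]].
  case/negP: B0; rewrite -(intv_tail s Bt) setE.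
  by apply/eqP/setP=> l; rewrite !inE; lia.
have BB' : B = B' by rewrite -(intv_tail s Bt) setE intv_tail.
suff -> : s = s' by rewrite BB'.
have : intv n s k = intv n s' k.
  by rewrite -(intv_head s _ Bt) // setE intv_head.
have [sk1|sk1] := leqP s k => sE.
  by have [] := intv_inj _ _ _ sE; lia.
have [sk1'|sk1'] := leqP s' k; last by lia.
by have [] := intv_inj _ _ _ (esym sE); lia.
Qed.

(** Criticality at a single level forces conditions independent of the level, and these give
    criticality at all large levels. The threshold [n.+1] supplies both [0 < m] and [n <= m]. *)
Lemma Ass_infty_plp (K : fieldType) (P : {mpoly K[n]} -> Prop) :
  Ass_infty (right_plp_ideal K n k d al be b) P <->
  exists2 X, ideal_eq P (var_prime K X) & plp_prime_set X.
Proof.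
split=> [[_ [m0 /(_ m0 (leqnn _))/Ass_plp_power[t [Pt crit]]]]|[X PX cond]].
  by exists (constraint_set t) => //; apply: critical_prime_set crit.
split; first exact: is_prime_ideal_eq (ideal_eq_sym PX) (var_prime_prime K X).
exists n.+1 => m nm; apply/Ass_plp_power.
have [||t tX crit] := prime_set_critical (m := m) _ _ cond; try lia.
by exists t; rewrite tX.
Qed.

Lemma Ass_infty_plp_var (K : fieldType) (X : {set 'I_n}) :
  Ass_infty (right_plp_ideal K n k d al be b) (var_prime K X) <-> plp_prime_set X.
Proof.
rewrite Ass_infty_plp; split=> [[Y /var_prime_inj->]//|]; by exists X.
Qed.

(** For intervals the condition suffices at every positive level, in particular at level 1; this
    yields the equivalence in (a). *)
Lemma Ass_plp_interval (K : fieldType) s t : 1 <= s -> s <= t -> t <= k ->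
  Ass (right_plp_ideal K n k d al be b) (var_prime K (intv n s t)) <->
  interval_condition s.-1 t.
Proof.
move=> s1 st tk; set I := right_plp_ideal _ _ _ _ _ _ _.
have I1 : ideal_eq (ideal_exp I 1) I by apply/ideal_exp1/ideal_gen_ideal.
split=> [AssI|cond].
  apply/plp_prime_set_interval => //.
  have /Ass_plp_power[c [/var_prime_inj-> crit]] :
      Ass (ideal_exp I 1) (var_prime K (intv n s t)).
    by apply: Ass_eq AssI => //; apply: ideal_eq_sym.
  exact: critical_prime_set crit.
apply: (Ass_eq I1 (@ideal_eq_refl _ _)); apply/Ass_plp_power.
have [c cE crit] := interval_critical (m := 1) isT s1 st tk cond.
by exists c; rewrite cE.
Qed.

End Reduced.

(** * Passage from the given data to reduced data *)

Section Reduction.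
Variables (n k d : nat) (alpha beta b : nat -> nat).
Local Notation tail := (intv n k.+1 n).

(* Replacing alpha k by max(alpha k, d - b(tail)) does not change the ideal. *)
Definition reduced_alpha i :=
  if i == 0 then 0 else if i == k then maxn (alpha k) (d - bsum b tail) else alpha i.

Hypothesis data : right_plp_data n k d alpha beta b.
Hypothesis beta0 : beta 0 = 0.
Hypothesis alpha_lt : forall i, 1 <= i <= k -> alpha i < beta i.
Hypothesis d_lt : d < beta k + bsum b tail.

Lemma reduced_plpP : reduced_plp n k d reduced_alpha beta b.
Proof.
have [/andP[k0 kn] d0 _ al_mono al_d be0 be_mono be_d b0 _] := data.
have step (f : nat -> nat) : (forall i, i < k -> f i <= f i.+1) ->
    forall i j, i <= j <= k -> f i <= f j.
  move=> fS i; elim=> [|j IHj]; first by rewrite leqn0 => /andP[/eqP->].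
  rewrite leq_eqVlt => /andP[/orP[/eqP->//|ij] jk].
  by apply: leq_trans (fS j jk); apply: IHj; rewrite -ltnS ij ltnW.
have k_neq0 : (k == 0) = false by lia.
split=> //; first exact: ltnW.
- apply: step => i ik; rewrite /reduced_alpha /=.
  case: posnP => // i0; rewrite (ltn_eqF ik); case: eqP => [ki|_].
    by rewrite leq_max -ki al_mono ?i0 // ki.
  by rewrite al_mono // i0.
- by apply: step => i ik; case: (posnP i) => [->|i0]; rewrite ?beta0 // be_mono ?i0.
- move=> i ik; rewrite /reduced_alpha; case: posnP => [i0|_]; first by lia.
  (* At i = k the raised lower bound stays below [beta k] because of [d_lt]. *)
  by case: eqP => [->|_]; [have := alpha_lt (i := k) | have := alpha_lt ik]; lia.
- rewrite /reduced_alpha k_neq0 eqxx; lia.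
Qed.

(** The tail carries at most [bsum b tail] of the degree [d], so the first [k] variables carry the
    rest. *)
Lemma reduced_right_plp_exponent u :
  right_plp_exponent (n := n) k d alpha beta b u <->
  right_plp_exponent k d reduced_alpha beta b u.
Proof.
have [/andP[k0 kn] _ _ _ _ _ _ _ _ _] := data.
split=> -[ab ub ud]; split=> // i ik; have := ab i ik; rewrite /reduced_alpha;
  have -> : (i == 0) = false by lia.
  case: eqP => // ->; rewrite geq_max -/(weight _ _) -/(csum _ _) => /andP[-> ->].
  rewrite !andbT -ud -csum_mdeg (csum_intv u (ltnW kn)) leq_subLR addnC leq_add2r.
  by apply: weight_bsum_le => l; rewrite in_intv => /andP[kl _]; apply: ub.
by case: eqP => [->|]; rewrite ?geq_max // => /andP[/andP[-> _] ->].
Qed.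

Lemma reduced_right_plp_ideal (K : fieldType) m :
  ideal_eq (ideal_exp (right_plp_ideal K n k d alpha beta b) m)
    (ideal_exp (right_plp_ideal K n k d reduced_alpha beta b) m).
Proof.
apply/ideal_exp_eq/ideal_gen_eq => f.
by split=> -[u /reduced_right_plp_exponent Eu ->]; exists u.
Qed.

Lemma Ass_infty_reduced (K : fieldType) (P : {mpoly K[n]} -> Prop) :
  Ass_infty (right_plp_ideal K n k d alpha beta b) P <->
  Ass_infty (right_plp_ideal K n k d reduced_alpha beta b) P.
Proof.
have redE := @reduced_right_plp_ideal K.
split=> -[prP [m0 AssP]]; split=> //; exists m0 => m /AssP; apply: Ass_eq => //.
exact: ideal_eq_sym.
Qed.

Lemma Ass_reduced (K : fieldType) (P : {mpoly K[n]} -> Prop) :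
  Ass (right_plp_ideal K n k d alpha beta b) P <->
  Ass (right_plp_ideal K n k d reduced_alpha beta b) P.
Proof.
have redE : ideal_eq (right_plp_ideal K n k d alpha beta b)
    (right_plp_ideal K n k d reduced_alpha beta b).
  apply: ideal_gen_eq => f.
  by split=> -[u /reduced_right_plp_exponent Eu ->]; exists u.
by split; apply: Ass_eq => //; apply: ideal_eq_sym.
Qed.

(** A nonempty [B] has positive [bsum b B], so d - b(tail) + b(tail - B) is below [d] when the
    subtraction is not truncated; hence the raised bound may be exchanged for [alpha k]. *)
Lemma reduced_tail_condition s (B : {set 'I_n}) :
  1 <= s <= k -> B != set0 -> B \subset tail ->
  tail_condition k d reduced_alpha beta b s.-1 B <->
  bsum b (tail :\: B) + maxn (beta s.-1) (alpha k) < d /\ beta s.-1 < beta s.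
Proof.
case: s => // s /= sk /set0Pn[l lB] Bt; have b0 := plp_b_gt0 data.
have bB : 0 < bsum b B.
  rewrite /bsum (bigD1 l) //= addn_gt0 b0 //.
  by move/subsetP/(_ l lB): Bt; rewrite in_intv.
have := bsumDC k b B; rewrite (setIidPl Bt) /tail_condition /reduced_alpha eqxx.
have -> : (k == 0) = false by lia.
move=> bE; split=> -[lt_d lt_be]; split=> //; lia.
Qed.

(** At j = k the maximum is [beta k], as the reduced lower bound stays strictly below it. *)
Lemma reduced_tail_condition_last (B : {set 'I_n}) :
  tail_condition k d reduced_alpha beta b k B <->
  bsum b (tail :\: B) + beta k < d.
Proof.
have := red_al_be reduced_plpP; have [/andP[k0 _] _ _ _ _ _ _ _ _ _] := data.
move=> /(_ k); rewrite k0 leqnn => /(_ isT) lt; rewrite /tail_condition ltnn.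
by split=> [[]|]; lia.
Qed.

End Reduction.

Theorem proposition6p11 (K : fieldType) (n k d : nat)
    (alpha beta b : nat -> nat) :
  right_plp_data n k d alpha beta b ->
  beta 0 = 0 ->
  (forall i : nat, 1 <= i <= k -> alpha i < beta i) ->
  d < beta k + bsum b (intv n k.+1 n) ->
  let I := right_plp_ideal K n k d alpha beta b in
  (forall (s t : nat) (B : {set 'I_n}),
     1 <= s -> s <= t -> t <= k ->
     B != set0 -> B \subset intv n k.+1 n ->
     [/\ (* (a) *)
         Ass_infty I (var_prime K (intv n s t)) <->
         Ass I (var_prime K (intv n s t)),
         (* (b) *)
         Ass_infty I (var_prime K B) <->
         bsum b (intv n k.+1 n :\: B) + beta k < d
       & (* (c) *)
         Ass_infty I (var_prime K (intv n s k :|: B)) <->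
         bsum b (intv n k.+1 n :\: B) + maxn (beta s.-1) (alpha k) < d /\
         beta s.-1 < beta s]) /\
  (forall P : {mpoly K[n]} -> Prop,
     Ass_infty I P <->
     [\/ exists s t : nat,
           [/\ 1 <= s, s <= t, t <= k,
               ideal_eq P (var_prime K (intv n s t))
             & Ass I (var_prime K (intv n s t))],
         exists B : {set 'I_n},
           [/\ B != set0, B \subset intv n k.+1 n,
               ideal_eq P (var_prime K B)
             & bsum b (intv n k.+1 n :\: B) + beta k < d]
       | exists (s : nat) (B : {set 'I_n}),
           [/\ 1 <= s <= k, B != set0 /\ B \subset intv n k.+1 n,
               ideal_eq P (var_prime K (intv n s k :|: B)),
               bsum b (intv n k.+1 n :\: B) + maxn (beta s.-1) (alpha k) < d
             & beta s.-1 < beta s]]).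
Proof.
move=> data beta0 alpha_lt d_lt I; set al := reduced_alpha n k d alpha b.
have red := reduced_plpP data beta0 alpha_lt d_lt.
have [/andP[k0 kn] _ _ _ _ _ _ _ _ _] := data.
have infE P : Ass_infty I P <->
    exists2 X, ideal_eq P (var_prime K X) & plp_prime_set k d al beta b X.
  by rewrite Ass_infty_reduced // Ass_infty_plp.
have infX X : Ass_infty I (var_prime K X) <->
    plp_prime_set k d al beta b X.
  by rewrite Ass_infty_reduced // Ass_infty_plp_var.
have AssI s t : 1 <= s -> s <= t -> t <= k ->
    Ass I (var_prime K (intv n s t)) <->
    interval_condition al beta s.-1 t.
  by move=> s1 st tk; rewrite Ass_reduced // Ass_plp_interval.
have tailE s (B : {set 'I_n}) : 1 <= s <= k -> B != set0 -> B \subset intv n k.+1 n ->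
    plp_prime_set k d al beta b (intv n s k :|: B) <->
    bsum b (intv n k.+1 n :\: B) + maxn (beta s.-1) (alpha k) < d /\ beta s.-1 < beta s.
  move=> sk B0 Bt; rewrite plp_prime_set_tail //; last by lia.
  exact: reduced_tail_condition.
have lastE (B : {set 'I_n}) : B != set0 -> B \subset intv n k.+1 n ->
    plp_prime_set k d al beta b B <->
    bsum b (intv n k.+1 n :\: B) + beta k < d.
  (* Here [B] is read as its union with the empty interval [k+1, k]. *)
  move=> B0 Bt; rewrite -[X in plp_prime_set _ _ _ _ _ X](set0U B) -(intv0 n (ltnSn k)).
  rewrite plp_prime_set_tail ?leqnn //.
  exact: reduced_tail_condition_last.
split=> [s t B s1 st tk B0 Bt|P].
  split; rewrite infX.
  - by rewrite AssI // plp_prime_set_interval.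
  - exact: lastE.
  - by apply: tailE => //; rewrite s1 (leq_trans st).
rewrite infE; split.
  case=> X PX [[s [t [s1 st tk XE cond]]]|[s [B [sk B0 Bt XE cond]]]].
    by constructor 1; exists s, t; rewrite -XE; split=> //; rewrite XE; apply/AssI.
  (* For s <= k the prime has the form in (c); the value s = k + 1 gives the form in (b). *)
  have [s_k|k_s] := leqP s k.
    constructor 3; exists s, B; have {}sk : 1 <= s <= k by lia.
    have [|lt_d lt_beta] := iffLR (tailE s B sk B0 Bt); last by split; rewrite -?XE.
    by right; exists s, B; split=> //; lia.
  constructor 2; exists B.
  have XB : X = B by rewrite XE intv0 ?set0U.
  split; rewrite -?XB //; try by rewrite XB.
  rewrite XB; apply/lastE => //; right; exists s, B; split=> //.
  by rewrite -XE XB.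
case=> [[s [t [s1 st tk PE /AssI cond]]]|[B [B0 Bt PE cond]]|
  [s [B [sk [B0 Bt] PE lt_d lt_beta]]]].
- by exists (intv n s t) => //; apply/plp_prime_set_interval => //; apply: cond.
- by exists B => //; apply/lastE.
- by exists (intv n s k :|: B) => //; apply/tailE.
Qed.
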